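(* Let $R$ be a complete local domain of mixed characteristic. If $\dim(R)>3$, then $R^{+}$ is not coherent.
   Context: Local rings are noetherian. Mixed characteristic means that $R$ has characteristic $0$ and its residue field has prime characteristic $p$. $R^{+}$ denotes the integral closure of $R$ inside an algebraic closure of its field of fractions. A ring is coherent if each of its finitely generated ideals is finitely presented. *)

(* Defs.v *)
From HB Require Import structures.
From mathcomp Require Import all_boot all_order all_algebra.
From mathcomp Require Import boolp classical_sets.

Set Implicit Arguments.
Unset Strict Implicit.
Unset Printing Implicit Defensive.

Import GRing.Theory.

Local Open Scope classical_set_scope.
Local Open Scope ring_scope.

Section FinitenessConditions.
Variable A : comNzRingType.

Definition finitely_generated (V : lmodType A) (N : set V) : Prop :=
  exists (n : nat) (v : 'I_n -> V),
    N = [set x | exists c : 'I_n -> A, x = \sum_(i < n) c i *: v i].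

Definition finitely_presented (V : lmodType A) (N : set V) : Prop :=
  exists (n : nat) (f : {linear 'rV[A]_n -> V}),
    range f = N /\ finitely_generated (f @^-1` [set 0]).

                                                                      
                                                                   
Definition coherent : Prop :=
  forall I : set A^o, finitely_generated I -> finitely_presented I.

                                                                      
                                                          
Definition noetherian : Prop :=
  forall I : idealr A, finitely_generated ([set` I] : set A^o).

Definition maximal_ideal (m : idealr A) : Prop :=
  forall I : idealr A, {subset m <= I} -> I =i m.

Definition local_ring (m : idealr A) : Prop :=
  maximal_ideal m /\ forall I : idealr A, maximal_ideal I -> I =i m.

Definition noetherian_local_ring (m : idealr A) : Prop :=
  noetherian /\ local_ring m.

                                                                         
Definition ideal_power (m : idealr A) (n : nat) : set A :=
  [set x | exists (k : nat) (c : 'I_k -> A) (a : 'I_k -> 'I_n -> A),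
     (forall i j, a i j \in m) /\
     x = \sum_(i < k) c i * \prod_(j < n) a i j].

                                                                          
                                                       
Definition adically_complete (m : idealr A) : Prop :=
  (forall x : A, (forall n, ideal_power m n x) -> x = 0) /\
  (forall u : nat -> A, (forall n, ideal_power m n (u n.+1 - u n)) ->
     exists l : A, forall n, ideal_power m n (u n - l)).

Definition prime_chain (n : nat) (P : 'I_n.+1 -> prime_idealr A) : Prop :=
  forall i j : 'I_n.+1, (i < j)%N ->
    {subset P i <= P j} /\ exists2 x, x \in P j & x \notin P i.

                                                                            
                          
Definition krull_dim_gt (d : nat) : Prop :=
  exists2 n : nat, (d < n)%N &
    exists P : 'I_n.+1 -> prime_idealr A, prime_chain P.

Definition mixed_characteristic (m : idealr A) : Prop :=
  [pchar A] =i pred0 /\ exists p : nat, p \in [pchar {ideal_quot m}].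

End FinitenessConditions.

Section IntegralClosure.
Variables (A : comNzRingType) (K : fieldType) (f : {rmorphism A -> K}).

Definition integral_elements : {pred K} := fun x => `[< integralOver f x >].

Lemma integral_elements_subring : subring_closed integral_elements.
Proof.
split=> [|x y|x y]; rewrite !unfold_in.
- by apply/asboolP; exact: integral1.
- by move=> /asboolP fx /asboolP fy; apply/asboolP; exact: integral_sub.
- by move=> /asboolP fx /asboolP fy; apply/asboolP; exact: integral_mul.
Qed.

HB.instance Definition _ :=
  GRing.isSubringClosed.Build K integral_elements integral_elements_subring.

Definition integral_closure : Type := {x : K | x \in integral_elements}.

HB.instance Definition _ := SubChoice.on integral_closure.
HB.instance Definition _ :=
  [SubChoice_isSubComNzRing of integral_closure by <:].

End IntegralClosure.

Definition is_algebraic_closure (F : fieldType) (K : closedFieldType)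
  (iota : {rmorphism F -> K}) : Prop := forall x : K, algebraicOver iota x.

                                                                           
Definition absolute_integral_closure (R : idomainType) (K : closedFieldType)
    (iota : {rmorphism {fraction R} -> K}) : comNzRingType :=
  integral_closure (iota \o @tofrac R).

(* Main.v *)
Require Import Defs.
From HB Require Import structures.
From mathcomp Require Import all_boot all_order all_algebra generic_quotient.
From mathcomp Require Import boolp classical_sets.
From mathcomp Require Import ring zify.

(** Write B for the absolute integral closure of R. On the quadric x y = z w
    no nonzero multiple of the Weil divisor x = w = 0 is Cartier, and the
    syzygies of (x, z), that is the pairs (r, s) with r z = s x, are generated
    over the coordinate ring by (x, z) and (w, y). Over B there are many more
    of them in the same degree: for every n and i <= n the pair
      (x^(1-i/n) w^(i/n), z^(1-i/n) y^(i/n))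
    is a syzygy, and these monomial syzygies are independent. Hence k pairs
    cannot generate all syzygies, as one sees by taking n > k, whereas over a
    coherent ring the syzygies of (x, z) are finitely generated
    ([coherent_syzygies]).

    The independence is seen on the lines w = l x, y = l z of one ruling of
    the quadric. Such a line is a quotient of B of dimension two in which
    every syzygy of (x, z) is a multiple rho (x, z) with rho in the quotient,
    and the i-th monomial syzygy becomes mu^i (x, z) with mu^n = l. Writing
    the monomial syzygies in terms of k generators, and doing so on more than
    k lines at once, factors a Vandermonde matrix in the mu modulo the maximal
    ideal through a space of dimension k; this is absurd as soon as the slopes
    l are distinct modulo the maximal ideal ([ruling_bound]).

    To find such a quadric, take a prime P0 of coheight three and a, b, c
    that generate an m-primary ideal modulo P0 ([system_of_parameters]), a
    root z of Z^2 - c Z + a b, and w = c - z, x = a, y = b. For every l,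
      (w - l a) (z - l a) = a (b - l c + l^2 a),
    so a prime of B that contains b - l c + l^2 a contains a line of slope l
    of one of the two rulings, which are exchanged by swapping z and w; the
    pigeonhole principle selects the ruling. The slopes are roots of pairwise
    coprime monic polynomials, so that a finite residue field does no harm;
    a determinant turns the condition on l into a condition on an element of
    m ([common_root_det]), Krull's principal ideal theorem in the form of
    [prime_between] provides primes P0 < P < P' < m of R that satisfy it, and
    [lying_over] carries P to B.

    Completeness enters twice. It makes every prime of B over m equal to a
    single one ([prime_over_unique], by lifting idempotents), so that the
    Vandermonde matrices of all lines live in one field. And it makes rho
    above integral ([integral_of_height_two]): on a complete local domain of
    dimension at least two, a fraction that a power of the maximal ideal
    multiplies into a finite extension ring is integral. *)

Set Implicit Arguments.
Unset Strict Implicit.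
Unset Printing Implicit Defensive.

Import GRing.Theory.

Local Open Scope classical_set_scope.
Local Open Scope ring_scope.

(** * Submodules and noetherian modules *)

Section Submodules.
Variables (R S : comNzRingType) (phi : {rmorphism R -> S}).
Implicit Types (N M L : set S) (s : seq S).

(** A ring morphism [phi : R -> S] stands for the R-module structure on [S]:
    with [phi] the identity the submodules are the ideals of R, and with
    [phi] a map to a field they include the finite extensions of its image. *)
Definition submod N : Prop :=
  [/\ N 0, forall u v, N u -> N v -> N (u + v) &
      forall r u, N u -> N (phi r * u)].

Lemma submodN N u : submod N -> N u -> N (- u).
Proof. by case=> _ _ NZ /(NZ (-1)); rewrite rmorphN1 mulN1r. Qed.

Lemma submodB N u v : submod N -> N u -> N v -> N (u - v).
Proof.
by move=> mN Nu Nv; have [_ ND _] := mN; apply: ND => //; apply: submodN.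
Qed.

Lemma submodI N M : submod N -> submod M -> submod (N `&` M).
Proof.
move=> [N0 ND NZ] [M0 MD MZ]; split => //.
- by move=> u v [Nu Mu] [Nv Mv]; split; [apply: ND | apply: MD].
- by move=> r u [Nu Mu]; split; [apply: NZ | apply: MZ].
Qed.

(** The recursion on the list of generators is what lets inductions peel off
    one generator at a time. *)
Fixpoint span s : set S :=
  if s is a :: s' then [set v | exists r, span s' (v - phi r * a)]
  else [set 0].

Lemma span_submod s : submod (span s).
Proof.
elim: s => [|a s [s0 sD sZ]] /=.
  by split=> [//|u v -> ->|r u ->]; rewrite ?addr0 ?mulr0.
split=> [|u v [r ur] [t vt]|r u [t ut]].
- by exists 0; rewrite rmorph0 mul0r subr0.
- exists (r + t); rewrite rmorphD.
  have -> : u + v - (phi r + phi t) * a = (u - phi r * a) + (v - phi t * a).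
    by ring.
  exact: sD.
- exists (r * t); rewrite rmorphM.
  have -> : phi r * u - phi r * phi t * a = phi r * (u - phi t * a) by ring.
  exact: sZ.
Qed.

Lemma span_mem s a : a \in s -> span s a.
Proof.
elim: s => // b s IH; rewrite inE => /orP[/eqP ->|/IH sa] /=.
  by exists 1; rewrite rmorph1 mul1r subrr; case: (span_submod s).
by exists 0; rewrite rmorph0 mul0r subr0.
Qed.

Lemma span_min s N : submod N -> (forall a, a \in s -> N a) -> span s `<=` N.
Proof.
move=> mN; have [N0 ND NZ] := mN.
elim: s => [_ v ->//|b s IH Ns v /= [r sv]].
rewrite -(subrK (phi r * b) v); apply: ND.
  by apply: IH sv => a sa; apply: Ns; rewrite inE sa orbT.
by apply/NZ/Ns; rewrite mem_head.
Qed.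

Definition noetherian_module M : Prop :=
  forall N, submod N -> N `<=` M -> exists s, N = span s.

(** The union of the chain is generated by finitely many elements, all of
    which lie in one member. *)
Lemma noetherian_chain M (N : nat -> set S) : noetherian_module M ->
  (forall i, submod (N i)) -> (forall i, N i `<=` N i.+1) ->
  (forall i, N i `<=` M) -> exists k, forall i, N i `<=` N k.
Proof.
move=> nM mN Nup NM.
have Nmono i j : (i <= j)%N -> N i `<=` N j.
  move=> /subnKC <-; elim: (j - i)%N => [|d IH]; first by rewrite addn0.
  by rewrite addnS => v /IH /Nup.
have mU : submod (\bigcup_i N i).
  split=> [|u v [i _ Ni] [j _ Nj]|r u [i _ Ni]].
  - by exists 0%N => //; case: (mN 0%N).
  - exists (maxn i j) => //; case: (mN (maxn i j)) => _ ND _.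
    by apply: ND; [apply: Nmono Ni; apply: leq_maxl
                  |apply: Nmono Nj; apply: leq_maxr].
  - by exists i => //; case: (mN i) => _ _; apply.
have [s Us] : exists s, \bigcup_i N i = span s.
  by apply: nM mU _ => v [i _ /NM].
have sU a : a \in s -> exists i, N i a.
  by move=> /span_mem; rewrite -Us => -[i _ ?]; exists i.
have [k sk] : exists k, forall a, a \in s -> N k a.
  elim: s sU {Us} => [|a s IH] sU; first by exists 0%N.
  have [k sk] := IH (fun b sb => sU b (mem_behead (s := a :: s) sb)).
  have [i Nia] := sU a (mem_head _ _).
  exists (maxn i k) => b; rewrite inE => /orP[/eqP ->|/sk].
    by apply: Nmono Nia; apply: leq_maxl.
  by apply: Nmono; apply: leq_maxr.
by exists k => i v Niv; apply: (span_min (mN k) sk); rewrite -Us; exists i.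
Qed.

Lemma noetherian_max M (F : set (set S)) : noetherian_module M ->
  (forall N, F N -> submod N /\ N `<=` M) -> (exists N, F N) ->
  exists2 N, F N & forall N', F N' -> N `<=` N' -> N' `<=` N.
Proof.
move=> nM FM [N0 FN0]; apply: contrapT => nomax.
have step (A : {N | F N}) : {N' : {N | F N} |
    sval A `<=` sval N' /\ ~ (sval N' `<=` sval A)}.
  apply: cid; apply: contrapT => H; apply: nomax; exists (sval A).
    exact: svalP.
  move=> N' FN' NN'; apply: contrapT => NN; apply: H.
  by exists (exist _ N' FN').
pose f (A : {N | F N}) := sval (step A); pose c i := iter i f (exist _ N0 FN0).
have cP i := svalP (step (c i)).
have [k kmax] := @noetherian_chain M (fun i => sval (c i)) nM
  (fun i => (FM _ (svalP (c i))).1) (fun i => (cP i).1)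
  (fun i => (FM _ (svalP (c i))).2).
by case: (cP k) => _; apply; apply: (kmax k.+1).
Qed.

End Submodules.

Arguments submod {R S} phi N.
Arguments span {R S} phi s.
Arguments noetherian_module {R S} phi M.

Notation ideal := (submod idfun).

Definition noetherian_ring (R : comNzRingType) : Prop :=
  noetherian_module (@idfun R : {rmorphism R -> R}) setT.

(** Peel off a generator [a]: the coefficients of [a] in elements of [N] form
    a finitely generated ideal, and lifts of its generators, together with
    generators of the part of [N] spanned by the other generators, span [N]. *)
Lemma noetherian_span (R S : comNzRingType) (phi : {rmorphism R -> S})
  (s : seq S) : noetherian_ring R -> noetherian_module phi (span phi s).
Proof.
move=> nR; elim: s => [|a s IH] N mN Ns.
  exists [::]; apply/seteqP; split=> // v ->; by case: mN.
have [N0 ND NZ] := mN; have [s0 sD sZ] := span_submod phi s.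
pose I := [set r : R | exists2 v, N v & span phi s (v - phi r * a)].
have mI : ideal I.
  split=> [|r t [u Nu ur] [v Nv vt]|r t [u Nu ut]].
  - by exists 0 => //; rewrite rmorph0 mul0r subr0.
  - exists (u + v); first exact: ND.
    rewrite rmorphD.
    have -> : u + v - (phi r + phi t) * a = (u - phi r * a) + (v - phi t * a).
      by ring.
    exact: sD.
  - exists (phi r * u); first exact: NZ.
    rewrite rmorphM.
    have -> : phi r * u - phi r * phi t * a = phi r * (u - phi t * a) by ring.
    exact: sZ.
have [t It] := nR _ mI (@subsetT _ _).
have lift_gens : exists2 ns, forall n, n \in ns -> N n &
    forall r, span idfun t r ->
      exists2 w, span phi ns w & span phi s (w - phi r * a).
  have : forall r, r \in t -> I r by move=> r /(@span_mem _ _ idfun); rewrite It.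
  elim: t {It} => [|r t IHt] tI.
    exists [::] => // r ->; exists 0 => //.
    by rewrite rmorph0 mul0r subr0.
  have [b bt|ns Nns nsP] := IHt.
    by apply: tI; rewrite inE bt orbT.
  have [n Nn nr] := tI r (mem_head _ _).
  exists (n :: ns).
    by move=> b; rewrite inE => /orP[/eqP ->//|/Nns].
  move=> b /= [e /nsP[w nsw sw]]; exists (phi e * n + w).
    by exists e; rewrite addrC addKr.
  move: sw; rewrite rmorphB rmorphM /= => sw.
  have -> : phi e * n + w - phi b * a =
    phi e * (n - phi r * a) + (w - (phi b - phi e * phi r) * a) by ring.
  by apply: sD sw; apply: sZ.
have [ns Nns nsP] := lift_gens.
have [u uP] := IH _ (submodI mN (span_submod phi s)) (@subIsetr _ _ _).
exists (ns ++ u).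
apply/seteqP; split=> [v Nv|]; last first.
  apply: span_min => // b; rewrite mem_cat => /orP[/Nns //|/(span_mem phi)].
  by rewrite -uP => -[].
have sub x y : {subset x <= y} -> span phi x `<=` span phi y.
  by move=> xy; apply: span_min (span_submod _ _) _ => b /xy /(span_mem phi).
have [r sr] := Ns _ Nv.
have : I r by exists v.
rewrite It => /nsP[w nsw sw].
have uvw : span phi u (v - w).
  rewrite -uP; split.
    exact: (submodB mN Nv (span_min mN Nns nsw)).
  have -> : v - w = (v - phi r * a) - (w - phi r * a) by ring.
  exact: (submodB (span_submod phi s) sr sw).
have [_ D _] := span_submod phi (ns ++ u).
rewrite -(subrK w v); apply: D.
  by apply: sub uvw => b bu; rewrite mem_cat bu orbT.
by apply: sub nsw => b bu; rewrite mem_cat bu.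
Qed.

Definition prime_set (R : comNzRingType) (P : set R) : Prop :=
  [/\ ideal P, ~ P 1 & forall a b, P (a * b) -> P a \/ P b].

Lemma prime_setX (R : comNzRingType) (P : set R) a n :
  prime_set P -> P (a ^+ n) -> P a.
Proof.
case=> mP P1 PM; elim: n => [//|n IH]; rewrite exprS => /PM[//|/IH //].
Qed.

(** * Descending chains of saturated submodules *)

Section DescendingChains.
Variables (R S : comNzRingType) (phi : {rmorphism R -> S}).
Variable Q : set R.
Hypotheses (nR : noetherian_ring R) (pQ : prime_set Q).
Implicit Types N M L : set S.

(** Submodules saturated with respect to a prime [Q] correspond to the
    submodules of the localization at [Q]; they allow local arguments without
    constructing localizations. *)
Definition saturated N := forall t v, ~ Q t -> N (phi t * v) -> N v.

Definition dcc N M := forall X : nat -> set S,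
  (forall i, [/\ submod phi (X i), saturated (X i), N `<=` X i & X i `<=` M]) ->
  (forall i, X i.+1 `<=` X i) -> exists k, forall i, X k `<=` X i.

(** After localization at [Q] the quotient M/N has finite length, since [Q] is
    the only prime that can be associated to it. To avoid lengths, take [L]
    maximal between [N] and [M] such that the chain condition holds up to [L].
    If [L] were not all of [M], an element [v] whose annihilator modulo [L] is
    maximal would have a prime annihilator, hence [Q]; the saturation [L'] of
    L + R v is then simple over [L], and the modular law extends the chain
    condition to [L']. *)
Lemma dcc_finite_length N M : noetherian_module phi M ->
  submod phi M -> saturated M -> submod phi N -> saturated N -> N `<=` M ->
  (forall v (a : set R), M v -> ~ N v -> prime_set a -> a `<=` Q ->
     [set r | N (phi r * v)] `<=` a -> Q `<=` a) ->
  dcc N M.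
Proof.
move=> nM mM satM mN satN NM H.
have [_ Q1 Qprime] := pQ.
pose F := [set L | [/\ submod phi L, saturated L, N `<=` L, L `<=` M & dcc N L]].
have [L [mL satL NL LM dccL] Lmax] : exists2 L, F L &
    forall L', F L' -> L `<=` L' -> L' `<=` L.
  apply: (noetherian_max nM) => [L [] //|]; exists N; split => // X XP _.
  exists 0%N => i v; have [_ _ _ /[apply]] := XP 0%N.
  by case: (XP i) => _ _ + _; apply.
have [ML|] := pselect (M `<=` L).
  move=> X XP; apply: dccL => i; case: (XP i) => ? ? ? XM.
  by split=> //; apply: subset_trans XM ML.
move=> /existsNP[v0 /not_implyP[Mv0 Lv0]].
have [L0 LD LZ] := mL; have [M0 MD MZ] := mM.
pose col v := [set r | L (phi r * v)].
have mcol v : ideal (col v).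
  split=> [|r t|r t]; rewrite /col /= ?rmorph0 ?mul0r // ?rmorphD ?mulrDl.
    exact: LD.
  by rewrite rmorphM -mulrA; apply: LZ.
have [_ [v [Mv Lv] ->] vmax] : exists2 I,
    [set I | exists2 v, M v /\ ~ L v & I = col v] I &
    forall I', [set I | exists2 v, M v /\ ~ L v & I = col v] I' ->
    I `<=` I' -> I' `<=` I.
  apply: (noetherian_max nR) => [_ [v _ ->]|]; first by split.
  by exists (col v0), v0.
have pcol : prime_set (col v).
  split=> // [|a b ab]; first by rewrite /col /= rmorph1 mul1r.
  have [|na] := pselect (col v a); first by left.
  right; apply: (vmax (col (phi a * v))).
  - by exists (phi a * v) => //; split => //; apply: MZ.
  - by move=> r /(LZ a); rewrite /col /= mulrCA.
  - by move: ab; rewrite /col /= rmorphM mulrA [phi b * _]mulrC.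
have colQ : col v `<=` Q.
  by move=> r /= Lr; apply: contrapT => /satL /(_ Lr).
have Qcol : Q `<=` col v.
  by apply: (H v (col v)) => // [/NL //|r /NL].
pose L' := [set u | exists2 t, ~ Q t & exists r, L (phi t * u - phi r * v)].
have QM a b : ~ Q a -> ~ Q b -> ~ Q (a * b) by move=> ? ? /Qprime[].
have LL' : L `<=` L'.
  by move=> u Lu; exists 1 => //; exists 0;
     rewrite rmorph0 rmorph1 mul0r mul1r subr0.
have mL' : submod phi L'.
  split=> [|u w [t Qt [r ur]] [t' Qt' [r' wr]]|a u [t Qt [r ur]]].
  - exact: LL'.
  - exists (t * t'); [exact: QM | exists (t' * r + t * r')].
    have -> : phi (t * t') * (u + w) - phi (t' * r + t * r') * v =
      phi t' * (phi t * u - phi r * v) + phi t * (phi t' * w - phi r' * v).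
      by rewrite rmorphD !rmorphM; ring.
    by apply: LD; apply: LZ.
  - exists t => //; exists (a * r).
    have -> : phi t * (phi a * u) - phi (a * r) * v =
      phi a * (phi t * u - phi r * v) by rewrite rmorphM; ring.
    exact: LZ.
have L'M : L' `<=` M.
  move=> u [t Qt [r /LM ur]]; apply: satM Qt _.
  by rewrite -(subrK (phi r * v) (_ * u)); apply: MD => //; apply: MZ.
have /Lmax /(_ LL') L'L : F L'; last first.
  case: Lv; apply: L'L; exists 1 => //; exists 1.
  by rewrite rmorph1 mul1r subrr.
split=> //; [|exact: subset_trans LL'|].
  move=> t u Qt [t' Qt' [r ur]]; exists (t' * t); first exact: QM.
  by exists r; rewrite rmorphM -mulrA.
move=> X XP Xdec.
have Xmono i j : (i <= j)%N -> X j `<=` X i.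
  move=> /subnKC <-; elim: (j - i)%N => [|d IH]; first by rewrite addn0.
  by rewrite addnS => w /Xdec /IH.
have [i|i w [/Xdec Xw Lw]//|k kP] := dccL (fun i => X i `&` L).
  case: (XP i) => mX satX NX _; split.
  - exact: submodI.
  - by move=> t w Qt [Xw Lw]; split; [apply: satX Qt Xw | apply: satL Qt Lw].
  - by move=> w Nw; split; [apply: NX | apply: NL].
  - by move=> w [].
have [[i [ki XL]]|noXL] := pselect (exists i, (k <= i)%N /\ X i `<=` L).
  exists i => j w Xw.
  have [] // : (X j `&` L) w.
  by apply: kP; split; [exact: Xmono ki _ Xw | exact: XL].
(* The members of the chain have the same intersection with [L] from [k] on,
   and all of them have the same sum with [L] up to saturation, namely [L']. *)
exists k => i u Xu.
have [ik|/ltnW ki] := leqP i k; first exact: Xmono ik _ Xu.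
have /existsNP[u' /not_implyP[Xu' Lu']] : ~ (X i `<=` L).
  by move=> XL; apply: noXL; exists i.
have [mXk satXk _ XkL'] := XP k; have [mXi satXi _ _] := XP i.
have [t Qt [r ur]] := XkL' _ Xu.
have [t' Qt' [r' ur']] := XkL' _ (Xmono _ _ ki _ Xu').
have Qr' : ~ Q r'.
  move=> /Qcol r'v; case: Lu'; apply: satL Qt' _.
  by rewrite -(subrK (phi r' * v) (_ * u')); apply: LD.
have Xd : (X k `&` L) (phi (r' * t) * u - phi (r * t') * u').
  split.
    have [_ _ XZ] := mXk.
    exact: (submodB mXk (XZ _ _ Xu) (XZ _ _ (Xmono _ _ ki _ Xu'))).
  have -> : phi (r' * t) * u - phi (r * t') * u' =
    phi r' * (phi t * u - phi r * v) - phi r * (phi t' * u' - phi r' * v).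
    by rewrite !rmorphM; ring.
  exact: (submodB mL (LZ _ _ ur) (LZ _ _ ur')).
have [_ XiD XiZ] := mXi.
apply: satXi (QM _ _ Qr' Qt) _.
rewrite -(subrK (phi (r * t') * u') (_ * u)).
by apply: XiD (XiZ _ _ Xu'); case: (kP i _ Xd).
Qed.

End DescendingChains.

(** * Primes in a noetherian ring *)

Section Ideals.
Variable R : comNzRingType.
Implicit Types I J P Q : set R.

Lemma ideal_max (F : set (set R)) : noetherian_ring R ->
  (forall I, F I -> ideal I) -> (exists I, F I) ->
  exists2 I, F I & forall I', F I' -> I `<=` I' -> I' `<=` I.
Proof.
by move=> nR Fid; apply: (noetherian_max nR) => I FI; split=> //; apply: Fid.
Qed.

Definition adjoin I g : set R := [set r | exists s, I (r - s * g)].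

Lemma adjoin_ideal I g : ideal I -> ideal (adjoin I g).
Proof.
move=> [I0 ID IZ]; split=> [|u v [s us] [t vt]|r u [s us]].
- by exists 0; rewrite mul0r subr0.
- exists (s + t).
  have -> : u + v - (s + t) * g = (u - s * g) + (v - t * g) by ring.
  exact: ID.
- exists (r * s).
  have -> : idfun r * u - r * s * g = r * (u - s * g) by rewrite /=; ring.
  exact: IZ.
Qed.

Lemma adjoin_sub I g : I `<=` adjoin I g.
Proof. by move=> u Iu; exists 0; rewrite mul0r subr0. Qed.

Lemma adjoin_mem I g : ideal I -> adjoin I g g.
Proof. by case=> I0 _ _; exists 1; rewrite mul1r subrr. Qed.

Lemma adjoin_min I J g : ideal J -> I `<=` J -> J g -> adjoin I g `<=` J.
Proof.
move=> [J0 JD JZ] IJ Jg u [s /IJ us].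
by rewrite -(subrK (s * g) u); apply: JD => //; apply: JZ.
Qed.

Lemma ideal_mulr I a b : ideal I -> I b -> I (a * b).
Proof. by case=> _ _ IZ; apply: IZ. Qed.

Lemma prime_notM Q a b : prime_set Q -> ~ Q a -> ~ Q b -> ~ Q (a * b).
Proof. by move=> [_ _ QM] Qa Qb /QM[]. Qed.

(** Krull's principal ideal theorem: if [g] is in [Q] and [P'] lies strictly
    between [P] and [Q], then [Q] is not minimal over P + (g). Otherwise, with
    [e] in [P'] but not in [P], let [W k] be the set of elements that a power
    of [g] brings into e^k R + P, up to denominators outside [Q]. Modulo [g]
    these ideals stabilize by the descending chain condition, whence
    W k = W (k+1) + g (W k) locally. Iterating this and cancelling e^k yields
    g^s (t - g h) in e R + P with [t] outside [Q], which is impossible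
    modulo [P']. *)
Lemma prime_between P P' Q g : noetherian_ring R ->
    prime_set P -> prime_set P' -> prime_set Q ->
    P `<=` P' -> ~ (P' `<=` P) -> P' `<=` Q -> ~ (Q `<=` P') -> Q g ->
  exists P1, [/\ prime_set P1, P `<=` P1 /\ ~ (P1 `<=` P),
                 P1 `<=` Q /\ ~ (Q `<=` P1) & P1 g].
Proof.
move=> nR pP pP' pQ PP' P'P P'Q QP' Qg.
have [Pg|nPg] := pselect (P g); first by exists P'; split => //; apply: PP'.
apply: contrapT => noP1.
have H A : prime_set A -> P `<=` A -> A `<=` Q -> A g -> Q `<=` A.
  move=> pA PA AQ Ag; apply: contrapT => QA; apply: noP1.
  by exists A; split => //; split=> // /(_ _ Ag).
have nP'g : ~ P' g by move=> P'g; apply: QP'; apply: H.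
have [e [P'e Pe]] : exists e, P' e /\ ~ P e.
  apply: contrapT => noe; apply: P'P => e P'e; apply: contrapT => Pe.
  by apply: noe; exists e.
have [[mP P1 PM] [mP' P'1 P'M] [mQ Q1 QM]] := And3 pP pP' pQ.
have [[P0 PD PZ] [Q0 QD QZ]] := conj mP mQ.
pose V S T k := [set a | exists h, P (T * g ^+ S * a - e ^+ k * h)].
have mV S T k : ideal (V S T k).
  split=> [|u v [h uh] [h' vh]|r u [h uh]].
  - by exists 0; rewrite !mulr0 subr0.
  - exists (h + h').
    have -> : T * g ^+ S * (u + v) - e ^+ k * (h + h') =
      (T * g ^+ S * u - e ^+ k * h) + (T * g ^+ S * v - e ^+ k * h') by ring.
    exact: PD.
  - exists (r * h).
    have -> : T * g ^+ S * (idfun r * u) - e ^+ k * (r * h) =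
      r * (T * g ^+ S * u - e ^+ k * h) by rewrite /=; ring.
    exact: PZ.
have Vmono S S' T T' k : V S T k `<=` V (S + S')%N (T' * T) k.
  move=> a [h ah]; exists (T' * g ^+ S' * h).
  have -> : T' * T * g ^+ (S + S') * a - e ^+ k * (T' * g ^+ S' * h) =
      (T' * g ^+ S') * (T * g ^+ S * a - e ^+ k * h) by rewrite exprD; ring.
  exact: PZ.
pose W k := [set a | exists S, exists2 T, ~ Q T & V S T k a].
have VW S T k : ~ Q T -> V S T k `<=` W k by move=> QT a Va; exists S, T.
have mW k : ideal (W k).
  split=> [|u v [S [T QT uh]] [S' [T' QT' vh]]|r u [S [T QT uh]]].
  - by apply: (VW 0%N 1 k Q1); case: (mV 0%N 1 k).
  - apply: (VW (S + S')%N (T' * T) k (prime_notM pQ QT' QT)).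
    case: (mV (S + S')%N (T' * T) k) => _ D _; apply: D; first exact: Vmono.
    by rewrite addnC mulrC; apply: Vmono.
  - by apply: (VW S T) => //; case: (mV S T k) => _ _; apply.
have PW k : P `<=` W k.
  move=> a Pa; apply: (VW 0%N 1 k Q1); exists 0.
  by rewrite expr0 !mul1r mulr0 subr0.
have Wg k a : W k (g * a) -> W k a.
  move=> [S [T QT [h ah]]]; exists S.+1, T => //; exists h.
  suff -> : T * g ^+ S.+1 * a = T * g ^+ S * (g * a) by [].
  by rewrite exprSr; ring.
have Wdec k : W k.+1 `<=` W k.
  move=> a [S [T QT [h ah]]]; exists S, T => //; exists (e * h).
  by rewrite mulrA -exprSr.
pose sat I := [set a | exists2 t, ~ Q t & adjoin I g (t * a)].
have msat I : ideal I -> ideal (sat I).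
  move=> mI; have [A0 AD AZ] := adjoin_ideal g mI.
  split=> [|u v [t Qt ut] [t' Qt' vt]|r u [t Qt ut]].
  - by exists 1 => //; rewrite mulr0.
  - exists (t * t'); first exact: prime_notM.
    have -> : t * t' * (u + v) = t' * (t * u) + t * (t' * v) by ring.
    by apply: AD; apply: AZ.
  - exists t => //; rewrite mulrCA; exact: AZ.
have satsat I : saturated idfun Q (sat I).
  move=> t v Qt [t' Qt' vt]; exists (t' * t); first exact: prime_notM.
  by rewrite -mulrA.
have subsat I : I `<=` sat I.
  by move=> a Ia; exists 1 => //; rewrite mul1r; apply: adjoin_sub.
have [mPsat satP] := conj (msat _ mP) (satsat P).
have satmono I J : I `<=` J -> sat I `<=` sat J.
  by move=> IJ a [t Qt [s /IJ ?]]; exists t => //; exists s.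
have [k kP] : exists k, forall i, sat (W k) `<=` sat (W i).
  have dP : dcc idfun Q (sat P) setT.
    apply: (dcc_finite_length nR pQ) => // v A _ _ pA AQ satA.
    have cA r : adjoin P g r -> A r.
      move=> Pr; apply: satA => /=; exists 1 => //=.
      by rewrite mul1r mulrC; apply: ideal_mulr Pr; apply: adjoin_ideal.
    apply: H => // [r Pr|]; first by apply/cA/adjoin_sub.
    exact/cA/adjoin_mem.
  apply: (dP (fun i => sat (W i))) => i.
    by split; [exact: msat|exact: (satsat (W i))|exact: satmono|].
  exact: (satmono _ _ (@Wdec i)).
(* As [W k] is finitely generated, one power of [g] and one denominator serve
   for all its elements. *)
have [S [T QT ST]] : exists S, exists2 T, ~ Q T & W k `<=` V S T k.
  have [s Ws] := nR _ (mW k) (@subsetT _ _).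
  have : forall a, a \in s -> W k a by move=> a /(@span_mem _ _ idfun); rewrite Ws.
  move=> sW; suff [S [T QT sV]] :
      exists S, exists2 T, ~ Q T & forall a, a \in s -> V S T k a.
    by exists S, T => //; rewrite Ws; apply: span_min.
  elim: s sW {Ws} => [|a s IH] sW; first by exists 0%N, 1.
  have [b bs|S [T QT sV]] := IH; first by apply: sW; rewrite inE bs orbT.
  have [S' [T' QT' aV]] := sW _ (mem_head _ _).
  exists (S + S')%N, (T' * T); first exact: prime_notM.
  move=> b; rewrite inE => /orP[/eqP ->|/sV]; last exact: Vmono.
  by rewrite addnC mulrC; apply: Vmono.
(* The exponent S+1 of [g] exceeds the S lost in [ST], which is what makes the
   factor t - g h appear below. *)
have [t [Qt [w [a [Ww Wa E]]]]] : exists t, ~ Q t /\ exists w a,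
    [/\ W k.+1 w, W k a & t * e ^+ k = w + g ^+ S.+1 * a].
  elim: S.+1 => [|j [t [Qt [w [a [Ww Wa E]]]]]].
    exists 1; split => //; exists 0, (e ^+ k); split.
    - by case: (mW k.+1).
    - apply: (VW 0%N 1) => //; exists 1.
      by rewrite expr0 !mul1r mulr1 subrr.
    - by rewrite expr0 add0r.
  have [t' Qt' [a' Wa']] := kP k.+1 _ (subsat _ _ Wa).
  exists (t' * t); split; first exact: prime_notM.
  exists (t' * w + g ^+ j * (t' * a - a' * g)), a'; split.
  - have [_ D Z] := mW k.+1; apply: D; [exact: Z | exact: Z].
  - apply: Wg.
    have -> : g * a' = t' * a - (t' * a - a' * g) by ring.
    apply: submodB (mW k) (ideal_mulr _ (mW k) Wa) (Wdec _ _ Wa').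
  - by rewrite -mulrA E exprSr; ring.
have [h ah] := ST _ Wa.
have [s [t2 Qt2 [h2 wh]]] := Ww.
have {E} : P (e ^+ k * (g ^+ (s + S) * t2 * (T * t - g * h) - T * g ^+ S * e * h2)).
  have -> : e ^+ k * (g ^+ (s + S) * t2 * (T * t - g * h) - T * g ^+ S * e * h2)
    = (T * g ^+ S) * (t2 * g ^+ s * w - e ^+ k.+1 * h2) +
      (t2 * g ^+ s * g ^+ S.+1) * (T * g ^+ S * a - e ^+ k * h).
    have -> : w = t * e ^+ k - g ^+ S.+1 * a by rewrite E addrK.
    by rewrite !exprSr exprD; ring.
  by apply: PD; apply: PZ.
move=> /PM[/(prime_setX pP)//|/PP' P'd].
have : P' (g ^+ (s + S) * t2 * (T * t - g * h)).
  rewrite -(subrK (T * g ^+ S * e * h2) (_ * _)).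
  have [_ D Z] := mP'; apply: D => //.
  have -> : T * g ^+ S * e * h2 = T * g ^+ S * h2 * e by ring.
  exact: Z.
move=> /P'M[/P'M[/(prime_setX pP')//|/P'Q//]|/P'Q QTt].
apply: (prime_notM pQ QT Qt).
rewrite -(subrK (g * h) (T * t)); apply: QD => //.
by rewrite mulrC; apply: QZ.
Qed.

(** A maximal counterexample [I] is not prime, hence contains a product [a * b]
    of elements outside it, and every prime above it contains [a] or [b]; join the lists for I + (a) and
    I + (b). *)
Lemma minimal_primes I : noetherian_ring R -> ideal I ->
  exists l : seq (set R), (forall P, P \in l -> prime_set P /\ I `<=` P) /\
    forall P, prime_set P -> I `<=` P -> exists2 P' : set R, P' \in l & P' `<=` P.
Proof.
move=> nR mI; apply: contrapT => bad.
pose F := [set I | ideal I /\ ~ exists l : seq (set R),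
    (forall P, P \in l -> prime_set P /\ I `<=` P) /\
    forall P, prime_set P -> I `<=` P -> exists2 P' : set R, P' \in l & P' `<=` P].
have {I mI bad} [I [mI bad] Imax] : exists2 J, F J &
    forall J', F J' -> J `<=` J' -> J' `<=` J.
  by apply: ideal_max => // [J []//|]; exists I; split.
have I1 : ~ I 1.
  move=> I1; apply: bad; exists [::]; split=> // P [_ P1 _] /(_ _ I1) //.
have npI : ~ prime_set I.
  move=> pI; apply: bad; exists [:: I]; split=> [P|P pP IP].
    by rewrite inE => /eqP ->; split.
  by exists I => //; rewrite mem_head.
have [a [b [Iab Ia Ib]]] : exists a b, [/\ I (a * b), ~ I a & ~ I b].
  apply: contrapT => nex; apply: npI; split=> // a b Iab.
  have [|Ia] := pselect (I a); first by left.
  right; apply: contrapT => Ib; apply: nex; by exists a, b.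
have get c : ~ I c -> exists l : seq (set R),
    (forall P, P \in l -> prime_set P /\ adjoin I c `<=` P) /\
    forall P, prime_set P -> adjoin I c `<=` P -> exists2 P' : set R, P' \in l & P' `<=` P.
  move=> Ic; apply: contrapT => badc; apply: Ic; apply: (Imax (adjoin I c)).
  - by split => //; apply: adjoin_ideal.
  - exact: adjoin_sub.
  - exact: adjoin_mem.
have [l [lP lmin]] := get a Ia; have [l' [lP' lmin']] := get b Ib.
apply: bad; exists (l ++ l'); split=> [P|P pP IP].
  by rewrite mem_cat => /orP[/lP|/lP'] [? IP]; split => //;
    apply: subset_trans IP; apply: adjoin_sub.
have [mP P1 PM] := pP.
have [Pa|Pb] := PM _ _ (IP _ Iab).
  have [|P' lP1 ?] := lmin P pP; first exact: adjoin_min.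
  by exists P' => //; rewrite mem_cat lP1.
have [|P' lP1 ?] := lmin' P pP; first exact: adjoin_min.
by exists P' => //; rewrite mem_cat lP1 orbT.
Qed.

(** If [x] avoids all primes of the list except the head [P], add to it an
    element of [I] that lies in all the other primes but not in [P]. Such an
    element exists unless [P] contains one of the others, which can then be
    dropped from the list. *)
Lemma prime_avoidance I (l : seq (set R)) : ideal I ->
  (forall P, P \in l -> prime_set P /\ ~ (I `<=` P)) ->
  exists2 x, I x & forall P, P \in l -> ~ P x.
Proof.
move=> mI; have [n] := ubnP (size l); elim: n l => // n IH [|P l] /= ln lP.
  by exists 0 => //; case: mI.
have lsub P' : P' \in l -> P' \in P :: l by move=> lP'; rewrite inE lP' orbT.
have [pP IP] := lP P (mem_head _ _).
have [[P' lP' P'P]|noP'] := pselect (exists2 P' : set R, P' \in l & P' `<=` P).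
  have [||x Ix xP] := IH (P :: rem P' l).
  - by rewrite /= size_rem // prednK //; case: (l) lP'.
  - move=> P2; rewrite inE => /orP[/eqP -> //|/mem_rem /lsub]; exact: lP.
  exists x => // P2; rewrite inE => /orP[/eqP ->|lP2].
    by apply: xP; rewrite mem_head.
  have [->|P2P'] := eqVneq P2 P'.
    by move=> /P'P; apply: xP; rewrite mem_head.
  apply: xP; rewrite inE; apply/orP; right.
  by move: lP2; rewrite (perm_mem (perm_to_rem lP')) inE (negPf P2P').
have [||x Ix xP] := IH l; [by [] | by move=> P2 /lsub /lP|].
have [Px|nPx] := pselect (P x); last first.
  by exists x => // P2; rewrite inE => /orP[/eqP ->|/xP].
have [y Iy [Py yP]] : exists2 y, I y & ~ P y /\ forall P', P' \in l -> P' y.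
  elim: (l) (noP') (fun P' lP' => (lP P' (lsub P' lP')).1) => [_ _|P' l' IHl noP pl].
    have /existsNP[y /not_implyP[]] := IP; by exists y.
  have [||y Iy [Py yP]] := IHl.
  - by move=> [P2 lP2 ?]; apply: noP; exists P2 => //; rewrite inE lP2 orbT.
  - by move=> P2 lP2; apply: pl; rewrite inE lP2 orbT.
  have /existsNP[z /not_implyP[P'z Pz]] : ~ (P' `<=` P).
    by move=> P'P; apply: noP; exists P' => //; rewrite mem_head.
  exists (z * y); first exact: ideal_mulr.
  split; first exact: prime_notM.
  move=> P2; rewrite inE => /orP[/eqP ->|lP2].
    by rewrite mulrC; apply: ideal_mulr P'z; case: (pl P' (mem_head _ _)).
  apply: ideal_mulr (yP _ lP2); have [] // := pl P2.
  by rewrite inE lP2 orbT.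
exists (x + y); first by case: mI => _ D _; apply: D.
move=> P2; rewrite inE => /orP[/eqP ->|lP2] Pxy.
  have [mP _ _] := pP; apply: Py.
  have -> : y = x + y - x by rewrite addrC addKr.
  exact: submodB mP Pxy Px.
apply: (xP _ lP2); rewrite -(addrK y x).
have [[mP2 _ _] _] := lP P2 (lsub _ lP2).
exact: submodB mP2 Pxy (yP _ lP2).
Qed.

(** An ideal that is maximal among those above [I] that contain no power of
    [t] is prime. *)
Lemma radical_primes I Q : noetherian_ring R -> ideal I ->
  (forall P, prime_set P -> I `<=` P -> Q `<=` P) ->
  forall t, Q t -> exists N, I (t ^+ N).
Proof.
move=> nR mI QP t Qt; apply: contrapT => noN.
pose F := [set J | [/\ ideal J, I `<=` J & forall N, ~ J (t ^+ N)]].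
have [J [mJ IJ Jt] Jmax] : exists2 J, F J &
    forall J', F J' -> J `<=` J' -> J' `<=` J.
  apply: ideal_max => // [J []//|]; exists I; split => // N IN.
  by apply: noN; exists N.
suff pJ : prime_set J by apply: (Jt 1%N); rewrite expr1; apply: (QP J).
split=> // [J1|a b Jab]; first by apply: (Jt 0%N).
have get c : ~ J c -> exists N, adjoin J c (t ^+ N).
  move=> Jc; apply: contrapT => bad; apply: Jc; apply: (Jmax (adjoin J c)).
  - split; [exact: adjoin_ideal | exact: subset_trans (@adjoin_sub _ _) |].
    by move=> N JN; apply: bad; exists N.
  - exact: adjoin_sub.
  - exact: adjoin_mem.
have [|Ja] := pselect (J a); first by left.
right; apply: contrapT => Jb.
have [N [s Ns]] := get a Ja; have [N' [s' Ns']] := get b Jb.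
apply: (Jt (N + N')%N); rewrite exprD.
have -> : t ^+ N * t ^+ N' = t ^+ N' * (t ^+ N - s * a) +
  (s * a) * (t ^+ N' - s' * b) + s * s' * (a * b) by ring.
have [_ D _] := mJ.
exact: (D _ _ (D _ _ (ideal_mulr _ mJ Ns) (ideal_mulr _ mJ Ns'))
  (ideal_mulr _ mJ Jab)).
Qed.

Fixpoint coheight_ge k P : Prop :=
  prime_set P /\ if k is k'.+1 then
    exists P', [/\ coheight_ge k' P', P `<=` P' & ~ (P' `<=` P)] else True.

Lemma coheight_prime k P : coheight_ge k P -> prime_set P.
Proof. by case: k => [|k] []. Qed.

(** Choose [b] outside the minimal primes over [I] of coheight greater than
    [k]; a prime above [I] of that coheight that contains [b] would lie
    strictly above a minimal one, whose coheight would be too large. *)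
Lemma parameter_exists k I Q : noetherian_ring R -> prime_set Q -> ideal I ->
  (forall P, prime_set P -> P `<=` Q) ->
  (forall P, prime_set P -> I `<=` P -> ~ coheight_ge k.+2 P) ->
  exists2 b, Q b & forall P, prime_set P -> adjoin I b `<=` P -> ~ coheight_ge k.+1 P.
Proof.
move=> nR [mQ _ _] mI loc hI.
have [l [lP lmin]] := minimal_primes nR mI.
pose l' := [seq P <- l | `[< coheight_ge k.+1 P >]].
have [P|b Qb lb] := @prime_avoidance Q l' mQ.
  rewrite mem_filter => /andP[/asboolP hP /lP[pP _]]; split=> // QP.
  have [_ [P' [/coheight_prime /loc P'Q PP' P'P]]] := hP.
  by apply: P'P; apply: subset_trans QP.
exists b => // P pP IP hP.
have [P' lP' P'P] := lmin P pP (subset_trans (@adjoin_sub I b) IP).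
have [PP'|PP'] := pselect (P `<=` P').
  have EP : P' = P by apply/seteqP.
  apply: (lb P); last exact/IP/adjoin_mem.
  by rewrite mem_filter -{2}EP lP' andbT; apply/asboolP.
have [pP' IP'] := lP _ lP'.
by apply: (hI P') => //; split=> //; exists P.
Qed.

(** A prime that is maximal among those of coheight at least three has coheight
    exactly three; three parameters then cut its coheight down to zero. *)
Lemma system_of_parameters Q : noetherian_ring R -> prime_set Q ->
  (forall P, prime_set P -> P `<=` Q) ->
  (exists P, coheight_ge 3 P) ->
  exists P a b c, [/\ coheight_ge 3 P, Q a /\ ~ P a, Q b, Q c &
    forall P', prime_set P' -> P `<=` P' -> P' a -> P' b -> P' c -> Q `<=` P'].
Proof.
move=> nR pQ loc ex3.
have [P hP Pmax] : exists2 P, [set P | coheight_ge 3 P] P &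
    forall P', [set P | coheight_ge 3 P] P' -> P `<=` P' -> P' `<=` P.
  by apply: ideal_max => // P' /coheight_prime[].
have [mP _ _] := coheight_prime hP.
have h4 P' : prime_set P' -> P `<=` P' -> ~ coheight_ge 4 P'.
  move=> pP' PP' [_ [P2 [h2 P'P2]]]; apply.
  exact: (subset_trans (Pmax P2 h2 (subset_trans PP' P'P2)) PP').
have [a Qa ha] := parameter_exists nR pQ mP loc h4.
have [b Qb hb] := parameter_exists nR pQ (adjoin_ideal a mP) loc ha.
have [c Qc hc] := parameter_exists nR pQ (adjoin_ideal b (adjoin_ideal a mP)) loc hb.
exists P, a, b, c; split=> //.
  split=> // Pa; apply: (ha P) => //; first exact: coheight_prime hP.
  exact: adjoin_min.
move=> P' pP' PP' P'a P'b P'c; apply: contrapT => QP'.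
have [mP' _ _] := pP'.
apply: (hc P') => //.
  by apply: adjoin_min => //; apply: adjoin_min => //; apply: adjoin_min.
by split=> //; exists Q; split=> //; apply: loc.
Qed.

End Ideals.

(** * Noetherian local rings *)

Section FromDefs.
Variable R : comNzRingType.

Lemma ideal_idealr (I : set R) : ideal I -> ~ I 1 ->
  exists J : idealr R, forall x, x \in J <-> I x.
Proof.
move=> mI I1; have [I0 ID IZ] := mI.
pose p : R -> bool := fun x => `[< I x >].
have pid : idealr_closed p.
  split=> [||a u v].
  - exact/asboolP.
  - by apply/negP => /asboolP.
  - move=> /asboolP Iu /asboolP Iv; apply/asboolP.
    by apply: ID => //; apply: IZ.
pose B := isIdealr.Build R p pid.
pose J : idealr R := HB.pack p B.
by exists J => x; split=> /asboolP.
Qed.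

Lemma idealr_ideal (J : idealr R) : ideal [set x | x \in J].
Proof.
split=> /= [|u v|r u]; first exact: rpred0.
  exact: rpredD.
exact: idealMr.
Qed.

Lemma noetherian_self : noetherian R -> noetherian_ring R.
Proof.
move=> nR I mI _.
have [I1|nI1] := pselect (I 1).
  exists [:: 1]; apply/seteqP; split=> [x _|x _] /=.
    by exists x; rewrite /= mulr1 subrr.
  by rewrite -[x]mulr1; apply: ideal_mulr.
have [J JI] := ideal_idealr mI nI1.
have [n [v vJ]] := nR J.
exists [seq v i | i <- enum 'I_n]; apply/seteqP; split=> x.
  move=> /JI xJ; have : [set` J] x by [].
  rewrite vJ => -[c ->].
  have [s0 sD sZ] := span_submod (@idfun R) [seq v i | i <- enum 'I_n].
  apply: (big_ind (span idfun [seq v i | i <- enum 'I_n])) => // i _.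
  by apply: sZ; apply: span_mem; rewrite map_f ?mem_enum.
apply: span_min => // a /mapP[i _ ->]; apply/JI.
suff : [set` J] (v i) by [].
rewrite vJ; exists (fun j => (j == i)%:R).
rewrite (bigD1 i) //= eqxx scale1r big1 ?addr0 // => j /negPf ->.
by rewrite scale0r.
Qed.

Variable m : idealr R.
Hypothesis locR : noetherian_local_ring m.

Let nR : noetherian_ring R := noetherian_self locR.1.

Lemma proper_ideal_local (I : set R) : ideal I -> ~ I 1 -> I `<=` [set x | x \in m].
Proof.
move=> mI I1.
pose F := [set J : set R | [/\ ideal J, ~ J 1 & I `<=` J]].
have [J [mJ J1 IJ] Jmax] : exists2 J, F J &
    forall J', F J' -> J `<=` J' -> J' `<=` J.
  by apply: ideal_max => // [J []//|]; exists I; split.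
have [J' J'P] := ideal_idealr mJ J1.
suff /(locR.2.2 J') J'm : maximal_ideal J'.
  by move=> x /IJ /J'P; rewrite J'm.
move=> L J'L x; apply/idP/idP; last exact: J'L.
move=> Lx; apply/J'P; apply: (Jmax [set x | x \in L]) => //.
  split; [exact: idealr_ideal | by rewrite /= idealr1|].
  by move=> y /IJ /J'P /J'L.
by move=> y /J'P /J'L.
Qed.

Lemma local_unit t : t \notin m -> exists u, u * t = 1.
Proof.
move=> tm; have [[u]|t1] := pselect (adjoin [set 0] t 1).
  by move=> /subr0_eq; exists u.
have m0 : ideal [set (0 : R)].
  by split=> // [u v -> ->|r u ->]; rewrite ?addr0 ?mulr0.
have /negP[] := tm.
by apply: (proper_ideal_local (adjoin_ideal t m0) t1); apply: adjoin_mem.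
Qed.

Lemma maximal_prime : prime_set [set x | x \in m].
Proof.
split=> [||a b /= ab]; [exact: idealr_ideal|by rewrite /= idealr1|].
have [|am] := boolP (a \in m); first by left.
have [u ua] := local_unit am.
by right; rewrite -[b]mul1r -ua -mulrA; apply: idealMr.
Qed.

Lemma prime_local P : prime_set P -> P `<=` [set x | x \in m].
Proof. by case=> mP P1 _; apply: proper_ideal_local. Qed.

Lemma krull_dim_coheight d : krull_dim_gt R d -> exists P : set R, coheight_ge d P.
Proof.
move=> [n dn [P Pchain]].
have pP (i : 'I_n.+1) : prime_set [set x | x \in P i].
  split=> [||a b /=]; [exact: idealr_ideal | by rewrite /= idealr1|].
  by rewrite prime_idealrM => /orP.
suff H k (i : 'I_n.+1) : (k + i = n)%N -> coheight_ge k [set x | x \in P i].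
  have lt : (n - d < n.+1)%N by rewrite ltnS leq_subr.
  exists [set x | x \in P (Ordinal lt)].
  by apply: H; rewrite /= subnKC // ltnW.
elim: k i => [|k IH] i kin; split=> //.
have lt : (i.+1 < n.+1)%N by move: (leq_addl k i); rewrite ltnS -ltnS -addSn kin.
have [sub [x xj xi]] := Pchain i (Ordinal lt) (ltnSn _).
exists [set x | x \in P (Ordinal lt)]; split.
- by apply: IH; rewrite /= addnS -addSn.
- exact: sub.
- by move=> /(_ x xj) /=; apply/negP.
Qed.

End FromDefs.

(** * Series in a complete local ring *)

Section IdealPowers.
Variables (R : comNzRingType) (m : idealr R).

Lemma ideal_power_ideal n : ideal (ideal_power m n).
Proof.
split=> [|u v|r u].
- exists 0%N, (fun _ => 0), (fun _ _ => 0); split=> [[]//|].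
  by rewrite big_ord0.
- move=> [k [c [a [am ->]]]] [l [d [b [bm ->]]]].
  exists (k + l)%N, (fun i => match split i with inl i => c i | inr i => d i end),
    (fun i => match split i with inl i => a i | inr i => b i end).
  split=> [i j|]; first by case: (split i).
  rewrite big_split_ord /=; congr (_ + _); apply: eq_bigr => i _.
    by rewrite (unsplitK (inl _ i)).
  by rewrite (unsplitK (inr _ i)).
- move=> [k [c [a [am ->]]]]; exists k, (fun i => r * c i), a; split=> //.
  by rewrite mulr_sumr; apply: eq_bigr => i _; rewrite mulrA.
Qed.

Lemma ideal_power_dec n x : ideal_power m n.+1 x -> ideal_power m n x.
Proof.
move=> [k [c [a [am ->]]]].
exists k, (fun i => c i * a i ord_max), (fun i j => a i (widen_ord (leqnSn n) j)).
split=> // ; apply: eq_bigr => i _.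
by rewrite big_ord_recr /= -!mulrA [\prod_(j < n) _ * _]mulrC.
Qed.

Lemma ideal_power_prod n (a : 'I_n -> R) c : (forall j, a j \in m) ->
  ideal_power m n (c * \prod_(j < n) a j).
Proof.
by move=> am; exists 1%N, (fun _ => c), (fun _ => a); rewrite big_ord1.
Qed.

Lemma ideal_power_mul n x y : x \in m -> ideal_power m n y ->
  ideal_power m n.+1 (x * y).
Proof.
move=> xm [k [c [a [am ->]]]].
exists k, c, (fun i j => if unlift ord0 j is Some j' then a i j' else x).
split=> [i j|]; first by case: (unlift _ _).
rewrite mulr_sumr; apply: eq_bigr => i _.
rewrite big_ord_recl unlift_none mulrCA; congr (_ * (_ * _)).
by apply: eq_bigr => j _; rewrite liftK.
Qed.

Lemma ideal_power1 x : ideal_power m 1 x <-> x \in m.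
Proof.
split=> [[k [c [a [am ->]]]]|xm].
  by apply: rpred_sum => i _; rewrite big_ord1; apply: idealMr.
by rewrite -[x]mul1r -[x](big_ord1 *%R (fun _ => x)); apply: ideal_power_prod.
Qed.

(** [C k] is the sum over i of y^i c_(k+i). The recursion between all the tails
    is the form in which the sum of the series can be used without taking
    limits again. *)
Lemma complete_series y (c : nat -> R) : adically_complete m -> y \in m ->
  exists C : nat -> R, forall k, C k = c k + y * C k.+1.
Proof.
move=> [sep lim] ym.
pose u k n := \sum_(i < n) y ^+ i * c (k + i)%N.
have yn n r : ideal_power m n (y ^+ n * r).
  by rewrite mulrC -[n in y ^+ n]card_ord -prodr_const; apply: ideal_power_prod.
have /choice[C CP] k : exists l, forall n, ideal_power m n (u k n - l).
  apply: lim => n; suff -> : u k n.+1 - u k n = y ^+ n * c (k + n)%N by [].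
  by rewrite /u big_ord_recr /= addrAC subrr add0r.
exists C => k; apply/esym/subr0_eq/sep => n.
have -> : c k + y * C k.+1 - C k = (u k n.+1 - C k) - y * (u k.+1 n - C k.+1).
  have -> : u k n.+1 = c k + y * u k.+1 n.
    rewrite /u big_ord_recl expr0 mul1r addn0 mulr_sumr; congr (_ + _).
    by apply: eq_bigr => i _; rewrite /= exprS mulrA addSnnS.
  by ring.
have mn := ideal_power_ideal n.
apply: (submodB mn); first exact/ideal_power_dec/CP.
exact: (ideal_mulr _ mn (CP _ _)).
Qed.

Lemma span_series (F : comNzRingType) (phi : {rmorphism R -> F}) s y
    (d : nat -> F) : adically_complete m -> y \in m ->
  (forall k, span phi s (d k)) ->
  exists2 D : nat -> F, (forall k, span phi s (D k)) &
    forall k, D k = d k + phi y * D k.+1.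
Proof.
move=> cR ym; elim: s d => [|a s IH] d ds.
  by exists (fun=> 0) => // k; rewrite (ds k) mulr0 addr0.
have /choice[c cP] k : exists c, span phi s (d k - phi c * a) := ds k.
have [C CE] := complete_series c cR ym.
have [D Ds DE] := IH _ cP.
exists (fun k => D k + phi (C k) * a) => k; first by exists (C k); rewrite addrK.
by rewrite DE CE rmorphD rmorphM; ring.
Qed.

End IdealPowers.

(** * Finite subrings and integral elements *)

Lemma monic_root_sum (R S : comNzRingType) (phi : {rmorphism R -> S})
    (f : {poly R}) u : f \is monic -> (map_poly phi f).[u] = 0 ->
  \sum_(i < (size f).-1) phi f`_i * u ^+ i + u ^+ (size f).-1 = 0.
Proof.
move=> fmon fu; have fl : (size f).-1.+1 = size f.
  by rewrite prednK // size_poly_gt0 monic_neq0.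
have E : (map_poly phi f).[u] = \sum_(i < size f) phi f`_i * u ^+ i.
  rewrite (horner_coef_wide _ (size_poly _ _)).
  by apply: eq_bigr => i _; rewrite coef_map.
rewrite -[RHS]fu E -[in RHS]fl big_ord_recr /=; congr (_ + _).
by move/monicP: fmon; rewrite /lead_coef => ->; rewrite rmorph1 mul1r.
Qed.

Section FiniteSubrings.
Variables (R : comNzRingType) (F : fieldType) (phi : {rmorphism R -> F}).
Hypothesis nR : noetherian_ring R.

Definition finite_subring (D : set F) : Prop :=
  [/\ submod phi D, D 1, forall u v, D u -> D v -> D (u * v) &
      exists s, D = span phi s].

Lemma finite_subring0 : exists D, finite_subring D.
Proof.
exists (span phi [:: 1]); split.
- exact: span_submod.
- by apply: span_mem; rewrite mem_head.
- move=> u v /= [r /subr0_eq ->] [t /subr0_eq ->]; exists (r * t).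
  by rewrite !mulr1 rmorphM subrr.
- by exists [:: 1].
Qed.

Lemma submod_sum N n (f : nat -> F) : submod phi N ->
  (forall i, (i < n)%N -> N (f i)) -> N (\sum_(i < n) f i).
Proof.
move=> [N0 ND _] Nf; elim: n Nf => [|n IH] Nf; first by rewrite big_ord0.
rewrite big_ord_recr; apply: ND; last exact: Nf.
by apply: IH => i ni; apply: Nf; rewrite ltnS ltnW.
Qed.

(** The generators are the products of those of [D] with the powers of [u]
    below the degree of a monic equation of [u]. *)
Lemma finite_subring_adjoin D u : finite_subring D -> integralOver phi u ->
  exists D', [/\ finite_subring D', D `<=` D' & D' u].
Proof.
move=> [mD D1 DM [s Ds]] [f fmon /rootP fu].
have [D0 DD DZ] := mD.
pose D' := [set v | exists2 p : {poly F}, forall i, D p`_i & v = p.[u]].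
have DsubD' : D `<=` D'.
  move=> d Dd; exists d%:P; last by rewrite hornerC.
  by move=> i; rewrite coefC; case: ifP.
exists D'; split=> //; last first.
  by exists 'X; rewrite ?hornerX // => i; rewrite coefX; case: eqP.
have mD' : submod phi D'.
  split=> [|_ _ [p Dp ->] [q Dq ->]|r _ [p Dp ->]]; first exact: DsubD'.
    by exists (p + q); rewrite ?hornerD // => i; rewrite coefD; apply: DD.
  by exists (phi r *: p); rewrite ?hornerZ // => i; rewrite coefZ; apply: DZ.
split=> //; first exact: DsubD'.
  move=> _ _ [p Dp ->] [q Dq ->]; exists (p * q); rewrite ?hornerM // => i.
  rewrite coefM; apply: (submod_sum (f := fun j => p`_j * q`_(i - j)%N) mD) => j _.
  exact: DM.
pose l := (size f).-1.
pose W := [seq v * u ^+ i | v <- s, i <- iota 0 l].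
exists W; apply/seteqP; split; last first.
  apply: span_min => // _ /allpairsP[[v i] [/= vs _ ->]].
  exists (v *: 'X^i); last by rewrite hornerZ hornerXn.
  move=> j; rewrite coefZ coefXn; case: eqP => _; last by rewrite mulr0.
  by rewrite mulr1 Ds; apply: span_mem.
have mW := span_submod phi W; have [W0 WD WZ] := mW.
suff DuW i d : D d -> span phi W (d * u ^+ i).
  move=> _ [p Dp ->]; rewrite horner_coef.
  by apply: (submod_sum (f := fun j => p`_j * u ^+ j) mW) => i _; apply: DuW.
have [n] := ubnP i; elim: n i d => // n IH i d; rewrite ltnS => ni Dd.
have [il|li] := ltnP i l.
  move: Dd; rewrite Ds.
  apply: (@span_min _ _ phi s [set d | span phi W (d * u ^+ i)]).
    split=> [|a b|r a] /=; rewrite ?mul0r ?mulrDl -?mulrA //; first exact: WD.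
    exact: WZ.
  by move=> a sa; apply: span_mem; apply: allpairs_f => //; rewrite mem_iota.
have -> : d * u ^+ i = \sum_(j < l) phi (- f`_j) * (d * u ^+ (i - l + j)).
  have /eqP := monic_root_sum fmon fu; rewrite addr_eq0 -/l => /eqP Eul.
  rewrite -{1}(subnK li) exprD -[u ^+ l]opprK -Eul mulrN mulrN !mulr_sumr -sumrN.
  by apply: eq_bigr => j _; rewrite rmorphN exprD; ring.
apply: (submod_sum (f := fun j => phi (- f`_j) * (d * u ^+ (i - l + j))) mW).
move=> j jl; apply: WZ; apply: IH => //.
by apply: leq_trans ni; rewrite -[X in (_ < X)%N](subnK li) ltn_add2l.
Qed.

Lemma finite_subring_seq (ws : seq F) : (forall w, w \in ws -> integralOver phi w) ->
  exists2 D, finite_subring D & forall w, w \in ws -> D w.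
Proof.
elim: ws => [|w ws IH] iws.
  by have [D ?] := finite_subring0; exists D.
have [|D fD Dws] := IH; first by move=> w' wws; apply: iws; rewrite inE wws orbT.
have [D' [fD' DD' D'w]] := finite_subring_adjoin fD (iws w (mem_head _ _)).
by exists D' => // w'; rewrite inE => /orP[/eqP ->|/Dws /DD'].
Qed.

(** The modules generated by [c] times the powers of [rho] up to a given one
    increase inside a noetherian module; where they become stationary, division
    by [c] gives a monic equation. *)
Lemma bounded_powers_integral D c rho : noetherian_module phi D -> submod phi D ->
  c != 0 -> (forall i, D (c * rho ^+ i)) -> integralOver phi rho.
Proof.
move=> nD mD c0 Dc; have [D0 DD DZ] := mD.
pose N i := [set v | exists2 p : {poly R},
  (size p <= i)%N & v = c * (map_poly phi p).[rho]].
have [k kmax] : exists k, forall i, N i `<=` N k.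
  apply: (@noetherian_chain _ _ phi D) => // i.
  - split=> [|_ _ [p sp ->] [q sq ->]|r _ [p sp ->]].
    + by exists 0; rewrite ?size_poly0 // rmorph0 horner0 mulr0.
    + exists (p + q); last by rewrite rmorphD hornerD mulrDr.
      by rewrite (leq_trans (size_polyD _ _)) // geq_max sp.
    + exists (r *: p); last by rewrite map_polyZ hornerZ mulrCA.
      exact: leq_trans (size_scale_leq _ _) sp.
  - by move=> _ [p sp ->]; exists p => //; apply: leqW.
  - move=> _ [p sp ->]; rewrite horner_coef mulr_sumr.
    apply: (submod_sum (f := fun j => c * ((map_poly phi p)`_j * rho ^+ j)) mD).
    by move=> j _; rewrite coef_map mulrCA; apply: DZ.
have [p sp E] : N k (c * rho ^+ k).
  apply: (kmax k.+1); exists 'X^k; first by rewrite size_polyXn.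
  by rewrite map_polyXn hornerXn.
exists ('X^k - p).
  have := lead_coefDl (p := 'X^k) (q := - p).
  by rewrite size_polyN size_polyXn ltnS sp lead_coefXn => /(_ isT) /eqP.
rewrite /root rmorphB /= map_polyXn hornerD hornerN hornerXn subr_eq0.
exact/eqP/(mulfI c0).
Qed.

Lemma finite_subring_integral D d : finite_subring D -> D d -> integralOver phi d.
Proof.
move=> [mD D1 DM [s Ds]] Dd; apply: (bounded_powers_integral (D := D) (c := 1)) => //.
- by rewrite Ds; apply: noetherian_span.
- exact: oner_neq0.
- move=> i; rewrite mul1r; elim: i => [|i IH]; first by rewrite expr0.
  by rewrite exprS; apply: DM.
Qed.

End FiniteSubrings.

(** * Integrality of fractions with a primary conductor *)

Lemma local_saturated (R S : comNzRingType) (phi : {rmorphism R -> S})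
    (m : idealr R) (N : set S) : noetherian_local_ring m -> submod phi N ->
  saturated phi [set x | x \in m] N.
Proof.
move=> locR [_ _ NZ] t v /negP tm Ntv.
have [u ut] := local_unit locR tm.
by rewrite -[v]mul1r -(rmorph1 phi) -ut rmorphM -mulrA; apply: NZ.
Qed.

Section Extension.
Variables (R : comNzRingType) (m : idealr R).
Hypotheses (locR : noetherian_local_ring m) (cR : adically_complete m).
Variables (F : fieldType) (phi : {rmorphism R -> F}).

Let nR : noetherian_ring R := noetherian_self locR.1.

(** Let [E] be the ring generated by [D] and [rho]; every element of the
    maximal ideal acts nilpotently on each element of E/D. The elements of E/D killed by [y]
    form a module of finite length, so its intersections with the multiples of
    the y^j are stationary, and therefore y^j E is contained in
    D + y^(j+1) E for some [j]. Expanding y^j q repeatedly gives a power series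
    in [y] with coefficients in [D], which converges in [D] by completeness.
    What remains, y^j q minus its sum, is infinitely divisible by [y] in [E],
    hence zero: this is where an element [t] with no power in y D is used, by
    an ascending chain argument after inverting [t]. So y^j E is contained in
    [D], which makes [E] finite. *)
Lemma conductor_integral D rho y t : finite_subring phi D ->
  (forall t', t' \in m -> exists N, D (phi t' ^+ N * rho)) ->
  y \in m -> phi y != 0 -> t \in m ->
  (forall s d, D d -> phi t ^+ s <> phi y * d) ->
  integralOver phi rho.
Proof.
move=> fD Drho ym y0 tm ty.
have [mD D1 DM [s Ds]] := fD.
have [D0 DD DZ] := mD.
have nD : noetherian_module phi D by rewrite Ds; apply: noetherian_span.
have DphiX r n : D (phi r ^+ n) by rewrite -rmorphXn -[phi _]mulr1; apply: DZ.
have DX d n : D d -> D (d ^+ n).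
  by move=> Dd; elim: n => [|n IH]; rewrite ?expr0 // exprS; apply: DM.
pose E := [set q | exists2 p : {poly F}, forall i, D p`_i & q = p.[rho]].
have DE : D `<=` E.
  move=> d Dd; exists d%:P; last by rewrite hornerC.
  by move=> i; rewrite coefC; case: ifP.
have mE : submod phi E.
  split=> [|_ _ [p Dp ->] [q Dq ->]|r _ [p Dp ->]]; first exact: DE.
    by exists (p + q); rewrite ?hornerD // => i; rewrite coefD; apply: DD.
  by exists (phi r *: p); rewrite ?hornerZ // => i; rewrite coefZ; apply: DZ.
have [E0 ED EZ] := mE.
have EZX r n q : E q -> E (phi r ^+ n * q) by rewrite -rmorphXn; apply: EZ.
have DZX r n q : D q -> D (phi r ^+ n * q) by rewrite -rmorphXn; apply: DZ.
(* Clear the denominators of [rho ^+ i] for all [i] up to the degree of [p]. *)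
have Etors q t' : t' \in m -> E q -> exists N, D (phi t' ^+ N * q).
  move=> /Drho[N DN] [p Dp ->]; exists (N * size p)%N.
  rewrite horner_coef mulr_sumr.
  apply: (submod_sum (f := fun i => phi t' ^+ (N * size p) * (p`_i * rho ^+ i)) mD).
  move=> i ip.
  have -> : phi t' ^+ (N * size p) * (p`_i * rho ^+ i) =
      phi t' ^+ (N * (size p - i)) * (p`_i * (phi t' ^+ N * rho) ^+ i).
    rewrite exprMn -exprM -{1}(subnK (ltnW ip)) mulnDr exprD; ring.
  by apply: DZX; apply: DM => //; apply: DX.
(* [I j] consists of the [d] in [D] such that d/y represents a multiple of
   y^j in E/D. *)
pose I j := [set d | D d /\
  exists2 d', D d' & exists2 e, E e & d = phi y * d' + phi y ^+ j.+1 * e].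
pose N := [set d | exists2 d', D d' & d = phi y * d'].
have mI j : submod phi (I j).
  split=> [|u v [Du [d1 Dd1 [e1 Ee1 Eu]]] [Dv [d2 Dd2 [e2 Ee2 Ev]]]
          |r u [Du [d1 Dd1 [e1 Ee1 Eu]]]].
  - by split=> //; exists 0 => //; exists 0 => //; rewrite !mulr0 addr0.
  - split; first exact: DD.
    exists (d1 + d2); first exact: DD.
    by exists (e1 + e2); [exact: ED | rewrite Eu Ev; ring].
  - split; first exact: DZ.
    exists (phi r * d1); first exact: DZ.
    by exists (phi r * e1); [exact: EZ | rewrite Eu; ring].
have mN : submod phi N.
  split=> [|_ _ [d1 Dd1 ->] [d2 Dd2 ->]|r _ [d1 Dd1 ->]].
  - by exists 0; rewrite ?mulr0.
  - by exists (d1 + d2); [exact: DD | rewrite mulrDr].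
  - by exists (phi r * d1); [exact: DZ | rewrite mulrCA].
have NI j : N `<=` I j.
  move=> _ [d Dd ->]; split; first exact: DZ.
  by exists d => //; exists 0 => //; rewrite mulr0 addr0.
have Idec j : I j.+1 `<=` I j.
  move=> u [Du [d Dd [e Ee Eu]]]; split=> //; exists d => //.
  exists (phi y * e); first exact: EZ.
  by rewrite mulrA -exprSr.
have I0 j : I j `<=` I 0%N.
  by elim: j => [|j IH] // u /Idec /IH.
have [j jP] : exists j, forall i, I j `<=` I i.
  have dI : dcc phi [set x | x \in m] N (I 0%N).
    apply: dcc_finite_length => //; try exact: local_saturated.
    - exact: maximal_prime.
    - by move=> M mM MI; apply: nD => // u /MI [].
    - move=> v a [Dv [d Dd [e Ee Ev]]] _ pa _ Na x xm.
      have [k Dk] := Etors e x xm Ee.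
      apply: (prime_setX (n := k) pa); apply: Na.
      exists (phi x ^+ k * d + phi x ^+ k * e).
        by apply: DD => //; apply: DZX.
      by rewrite Ev rmorphXn expr1; ring.
  by apply: dI => // i; split=> //; apply: local_saturated.
(* Induction on the power of [y] that kills the class of [phi y ^+ j * q] in
   E/D. *)
have div k q : E q -> D (phi y ^+ k * (phi y ^+ j * q)) ->
    exists2 d, D d & exists2 q', E q' & phi y ^+ j * q = d + phi y ^+ j.+1 * q'.
  elim: k q => [|k IH] q Eq Dq.
    exists (phi y ^+ j * q); first by rewrite expr0 mul1r in Dq.
    by exists 0 => //; rewrite mulr0 addr0.
  have : I j (phi y ^+ k.+1 * (phi y ^+ j * q)).
    split=> //; exists 0 => //; exists (phi y ^+ k * q); first exact: EZX.
    by rewrite !exprS; ring.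
  move=> /(jP (j + k).+1)[_ [d Dd [e Ee Eqe]]].
  have [||d' Dd' [q' Eq' Eq'']] := IH (q - phi y * e).
  - by apply: (submodB mE) => //; apply: EZ.
  - suff -> : phi y ^+ k * (phi y ^+ j * (q - phi y * e)) = d by [].
    apply: (mulfI y0).
    have -> : phi y * (phi y ^+ k * (phi y ^+ j * (q - phi y * e))) =
      phi y ^+ k.+1 * (phi y ^+ j * q) - phi y ^+ (j + k).+2 * e.
      by rewrite !exprS exprD; ring.
    by rewrite Eqe addrK.
  exists d' => //; exists (q' + e); first exact: ED.
  by rewrite mulrDr addrA -Eq'' exprS; ring.
have /choice[nxt nxtP] (q : {q | E q}) : exists dq : F * {q | E q}, D dq.1 /\
    phi y ^+ j * sval q = dq.1 + phi y ^+ j.+1 * sval dq.2.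
  have [k Dk] := Etors _ _ ym (EZX y j _ (svalP q)).
  have [d Dd [q' Eq' Edq]] := div k _ (svalP q) Dk.
  by exists (d, exist _ q' Eq').
have yE q : E q -> D (phi y ^+ j * q).
  move=> Eq; pose q_ i := iter i (fun q => (nxt q).2) (exist _ q Eq).
  have [Dl DDl DlE] : exists2 Dl : nat -> F, (forall k, D (Dl k)) &
      forall k, Dl k = (nxt (q_ k)).1 + phi y * Dl k.+1.
    rewrite Ds; apply: (span_series cR ym) => k; rewrite -Ds.
    by case: (nxtP (q_ k)).
  (* The successive remainders; each is [y] times the next one. *)
  pose h k := phi y ^+ j * sval (q_ k) - Dl k.
  have hE k : h k = phi y * h k.+1.
    rewrite /h DlE (nxtP (q_ k)).2 exprS -[(nxt (q_ k)).2]/(q_ k.+1); ring.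
  have Eh k : E (h k).
    by apply: (submodB mE) (DE _ (DDl k)); apply/EZX/svalP.
  (* [H k] is the ideal generated by [h k] after inverting [t]. Where these
     increasing ideals are stationary, a nonzero remainder would make a power
     of [t] a multiple of [y]. *)
  have [k hk] : exists k, h k = 0.
    pose H k := [set d | D d /\ exists n, exists2 d', D d' & phi t ^+ n * d = h k * d'].
    have [|||k kmax] := @noetherian_chain _ _ phi D H nD.
    - move=> k; split=> [|u v [Du [n [d Dd Eu]]] [Dv [n' [d' Dd' Ev]]]
                         |r u [Du [n [d Dd Eu]]]].
      + by split=> //; exists 0%N, 0; rewrite ?mulr0.
      + split; first exact: DD.
        exists (n + n')%N, (phi t ^+ n' * d + phi t ^+ n * d').
          by apply: DD; apply: DZX.
        have -> : phi t ^+ (n + n') * (u + v) =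
          phi t ^+ n' * (phi t ^+ n * u) + phi t ^+ n * (phi t ^+ n' * v).
          by rewrite exprD; ring.
        by rewrite Eu Ev; ring.
      + split; first exact: DZ.
        exists n, (phi r * d); first exact: DZ.
        by rewrite mulrCA Eu mulrCA.
    - move=> k u [Du [n [d Dd Eu]]]; split=> //; exists n, (phi y * d).
        exact: DZ.
      by rewrite Eu hE; ring.
    - by move=> k u [].
    exists k.+1; have [n Dn] := Etors _ _ tm (Eh k.+1).
    have [|_ [n' [d Dd Ed]]] := kmax k.+1 (phi t ^+ n * h k.+1).
      split=> //; exists 0%N, (phi t ^+ n) => //.
      by rewrite expr0 mul1r mulrC.
    apply/eqP; apply/negP => /negP hk0.
    apply: (ty (n' + n)%N d Dd); apply: (mulfI hk0).
    rewrite exprD mulrC -mulrA Ed hE; ring.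
  have h0 : h 0%N = 0.
    by elim: k hk => [//|k IH] hk; apply: IH; rewrite hE hk mulr0.
  by move/subr0_eq: h0 => /= ->.
apply: (bounded_powers_integral (D := D) (c := phi y ^+ j)) => //.
  by rewrite expf_neq0.
move=> i; apply: yE; exists 'X^i; last by rewrite hornerXn.
by move=> k; rewrite coefXn; case: eqP.
Qed.

(** The primes ker phi < P < m, separated by [y] and [t], say that the image of
    [phi] has dimension at least two. No power of [t] is a multiple of [y] in a
    finite extension: multiplying out the integral equation of the quotient
    would put a power of [t] into [P]. *)
Lemma integral_of_height_two P y t rho (ws : seq F) :
  prime_set P -> P y -> phi y != 0 -> t \in m -> ~ P t ->
  (forall r, phi r = 0 -> P r) ->
  (forall w, w \in ws -> integralOver phi w) ->
  (forall D, finite_subring phi D -> (forall w, w \in ws -> D w) ->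
     forall t', t' \in m -> exists N, D (phi t' ^+ N * rho)) ->
  integralOver phi rho.
Proof.
move=> pP Py y0 tm Pt kerP iws Hrho.
have [D fD Dws] := finite_subring_seq iws.
apply: (conductor_integral fD (Hrho D fD Dws) _ y0 tm).
  exact: prime_local pP _ Py.
move=> s d /(finite_subring_integral nR fD)[f fmon /rootP fd] E.
have [mP _ _] := pP; apply: Pt; apply: (prime_setX (n := s * (size f).-1) pP).
have := monic_root_sum fmon fd; set l := (size f).-1 => Ef.
have : phi (t ^+ (s * l) +
    y * \sum_(i < l) f`_i * t ^+ (s * i) * y ^+ (l - i).-1) = 0.
  transitivity (phi y ^+ l * (\sum_(i < l) phi f`_i * d ^+ i + d ^+ l)); last first.
    by rewrite Ef mulr0.
  rewrite rmorphD rmorphXn exprM E exprMn rmorphM rmorph_sum.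
  rewrite mulrDr [LHS]addrC; congr (_ + _).
  rewrite !mulr_sumr; apply: eq_bigr => i _.
  rewrite !rmorphM !rmorphXn exprM E exprMn.
  have -> : phi y ^+ l = phi y * phi y ^+ i * phi y ^+ (l - i).-1.
    rewrite -mulrA -exprD -exprS -addnS prednK ?subn_gt0 ?ltn_ord //.
    by rewrite subnKC // ltnW ?ltn_ord.
  ring.
move=> /kerP; set u := \sum_(i < l) _ => Pu.
have -> : t ^+ (s * l) = (t ^+ (s * l) + y * u) - u * y by ring.
exact: submodB mP Pu (ideal_mulr _ mP Py).
Qed.

End Extension.

(** * Residue fields and lying over *)

Section QuotientFields.

Lemma quotient_ring (B : comNzRingType) (q : set B) : ideal q -> ~ q 1 ->
  exists (T : comNzRingType) (pi : {rmorphism B -> T}),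
    (forall x, exists b, x = pi b) /\ forall b, pi b = 0 <-> q b.
Proof.
move=> mq q1; have [J Jq] := ideal_idealr mq q1.
exists {ideal_quot J}, \pi_({ideal_quot J})%qT; split=> [x|b].
  by exists (repr (x : {ideal_quot J})); rewrite /= reprK.
rewrite -(Jq b) -{2}[b]subr0 (Quotient.idealrBE J) -(rmorph0 \pi_({ideal_quot J})%qT).
by split=> /eqP.
Qed.

(** The inverses that the structure of integral domain asks for are chosen
    classically. *)
Lemma integral_domain_fraction (T : comNzRingType) :
  (forall x y : T, x * y = 0 -> x = 0 \/ y = 0) ->
  exists (F : fieldType) (f : {rmorphism T -> F}), injective f.
Proof.
move=> Tint.
pose inv (x : T) : T :=
  if pselect (exists y, y * x = 1) is left h then sval (cid h) else x.
pose unit : {pred T} := fun x => `[< exists y, y * x = 1 >].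
have mulVx : {in unit, left_inverse 1 inv *%R}.
  move=> x /asboolP h; rewrite /inv; case: pselect => // h'.
  by case: cid.
have unitPl x y : y * x = 1 -> unit x by move=> yx; apply/asboolP; exists y.
have inv_out : {in [predC unit], inv =1 id}.
  move=> x /negP h; rewrite /inv; case: pselect => // h'.
  by case: h; apply/asboolP.
pose U : comUnitRingType := HB.pack (T : Type)
  (GRing.ComNzRing_hasMulInverse.Build T mulVx unitPl inv_out)
  (GRing.ComNzRing.on T).
have Uint (x y : U) : x * y = 0 -> (x == 0) || (y == 0).
  by move=> /Tint[] ->; rewrite eqxx ?orbT.
pose D : idomainType := HB.pack (U : Type)
  (GRing.ComUnitRing_isIntegral.Build U Uint) (GRing.ComUnitRing.on U).
exists {fraction D}, (@tofrac D : {rmorphism D -> {fraction D}}) => x y.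
by move=> /eqP; rewrite tofrac_eq => /eqP.
Qed.

Lemma prime_quotient_field (B : comNzRingType) (q : set B) : prime_set q ->
  exists (F : fieldType) (psi : {rmorphism B -> F}), forall b, psi b = 0 <-> q b.
Proof.
move=> [mq q1 qM]; have [T [pi [pis piE]]] := quotient_ring mq q1.
have [x y|F [f finj]] := @integral_domain_fraction T.
  have [[a ->] [b ->]] := (pis x, pis y).
  by rewrite -rmorphM => /piE /qM[/piE|/piE]; [left | right].
exists F, (f \o pi) => b; rewrite -(piE b) /=; split=> [|->]; last exact: rmorph0.
by rewrite -(rmorph0 f) => /finj.
Qed.

Lemma residue_field (R : comNzRingType) (m : idealr R) :
  noetherian_local_ring m ->
  exists (k : fieldType) (chi : {rmorphism R -> k}),
    (forall x, exists r, x = chi r) /\ forall r, chi r = 0 <-> r \in m.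
Proof.
move=> locR; have [mm m1 _] := maximal_prime locR.
have [T [pi [pis piE]]] := quotient_ring mm m1.
pose inv (x : T) : T :=
  if pselect (exists y, y * x = 1) is left h then sval (cid h) else 0.
have mulVx (x : T) : x != 0 -> inv x * x = 1.
  have [r ->] := pis x => rm; rewrite /inv; case: pselect => [h|[]].
    by case: cid.
  have [|u ur] := @local_unit _ _ locR r.
    by apply: contra rm => rm; apply/eqP/piE.
  by exists (pi u); rewrite -rmorphM ur rmorph1.
have inv0 : inv 0 = 0.
  rewrite /inv; case: pselect => // h; exfalso; move: h => [y].
  by rewrite mulr0 => /esym /eqP; rewrite oner_eq0.
pose k : fieldType := HB.pack (T : Type)
  (GRing.ComNzRing_isField.Build T mulVx inv0) (GRing.ComNzRing.on T).
by exists k, (pi : {rmorphism R -> k}).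
Qed.

End QuotientFields.

Section IntegralExtension.
Variables (R B : comNzRingType) (j : {rmorphism R -> B}).
Hypothesis jint : forall b, integralOver j b.

(** Take [q] maximal among the ideals above [b] whose trace on R lies in [p].
    It is prime since the complement of [p] is multiplicative. If some [r] in
    [p] were missing from it, there would be [t] outside [p] with [j t]
    congruent to a multiple [s * j r] modulo [q]; multiplying the integral
    equation of [s] by the appropriate power of [j r] shows that a power of [t]
    lies in [p]. *)
Lemma lying_over (b : set B) (p : set R) : ideal b -> prime_set p ->
  (forall r, b (j r) -> p r) ->
  exists q, [/\ prime_set q, b `<=` q & forall r, q (j r) <-> p r].
Proof.
move=> mb pp bp; have [mp p1 pM] := pp.
pose good := [set q : set B | [/\ ideal q, b `<=` q & forall r, q (j r) -> p r]].
(* The empty set is admitted as well, because it is the union of the empty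
   chain. *)
have gb : good b by split.
have [q [qP qmax]] : exists q, (q = set0 \/ good q) /\
    forall q', q `<` q' -> ~ (q' = set0 \/ good q').
  apply: (@Zorn_bigcup _ [set q | q = set0 \/ good q]) => C CP Ctot.
  have [[X [CX gX]]|noX] := pselect (exists X, C X /\ good X); last first.
    left; apply/seteqP; split=> // v [X CX Xv].
    have [X0|gX] := CP X CX; first by rewrite X0 in Xv.
    by case: noX; exists X.
  have [mX bX Xp] := gX.
  have gC Y v : C Y -> Y v -> good Y.
    by move=> CY Yv; have [Y0|//] := CP Y CY; rewrite Y0 in Yv.
  right; split=> [|v /bX Xv|r [Y CY Yr]].
  - split=> [|u v [Y CY Yu] [Z CZ Zv]|r u [Y CY Yu]].
    + by exists X => //; case: mX.
    + have [YZ|ZY] := Ctot Y Z CY CZ.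
        exists Z => //; have [[_ D _] _ _] := gC _ _ CZ Zv.
        by apply: D => //; apply: YZ.
      exists Y => //; have [[_ D _] _ _] := gC _ _ CY Yu.
      by apply: D => //; apply: ZY.
    + by exists Y => //; case: (gC _ _ CY Yu) => mY _ _; apply: ideal_mulr.
  - by exists X.
  - by case: (gC _ _ CY Yr) => _ _; apply.
have {qP}gq : good q.
  case: qP => // q0; case: (qmax b); last by right.
  rewrite q0 properEneq; split=> //; apply/eqP => /esym b0.
  by case: mb => b00 _ _; rewrite b0 in b00.
have [mq bq qp] := gq.
have {}qmax c : ~ q c -> exists r s, ~ p r /\ q (j r - s * c).
  move=> qc; apply: contrapT => nors; apply: (qmax (adjoin q c)).
    rewrite properEneq; split; last exact: adjoin_sub.
    by apply/eqP => E; apply: qc; rewrite E; apply: adjoin_mem.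
  right; split; [exact: adjoin_ideal | exact: subset_trans (@adjoin_sub _ _ _) |].
  by move=> r [s rs]; apply: contrapT => pr; apply: nors; exists r, s.
exists q; split=> //.
  split=> // [q1|a c qac]; first by apply: p1; apply: qp; rewrite rmorph1.
  have [|qa] := pselect (q a); first by left.
  right; apply: contrapT => qc.
  have [r [s [pr rs]]] := qmax a qa; have [r' [s' [pr' rs']]] := qmax c qc.
  apply: (prime_notM pp pr pr'); apply: qp.
  have -> : j (r * r') = j r' * (j r - s * a) + (s * a) * (j r' - s' * c)
    + s * s' * (a * c) by rewrite rmorphM; ring.
  have [_ D _] := mq.
  exact: (D _ _ (D _ _ (ideal_mulr _ mq rs) (ideal_mulr _ mq rs'))
    (ideal_mulr _ mq qac)).
move=> r; split; first exact: qp.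
move=> pr; apply: contrapT => /qmax[t [s [pt ts]]].
have [f fmon /rootP fs] := jint s.
pose l := (size f).-1.
apply: pt; apply: (prime_setX (n := l) pp).
pose w := \sum_(i < l) f`_i * t ^+ i * r ^+ (l - i).-1.
have -> : t ^+ l = (t ^+ l + w * r) - w * r by rewrite addrK.
apply: (submodB mp) (ideal_mulr _ mp pr); apply: qp.
have qX i : q (j t ^+ i - (s * j r) ^+ i).
  by rewrite subrXX mulrC; apply: ideal_mulr.
have sq n (g : nat -> B) : (forall i, (i < n)%N -> q (g i)) -> q (\sum_(i < n) g i).
  have [q0 D _] := mq; elim: n => [|n IH] h; first by rewrite big_ord0.
  rewrite big_ord_recr; apply: D; last exact: h.
  by apply: IH => i il; apply/h/ltnW.
have E : (s * j r) ^+ l +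
    \sum_(i < l) j f`_i * (s * j r) ^+ i * j r ^+ (l - i).-1.+1 = 0.
  transitivity (j r ^+ l * (\sum_(i < l) j f`_i * s ^+ i + s ^+ l)); last first.
    by rewrite (monic_root_sum fmon fs) mulr0.
  rewrite mulrDr exprMn [LHS]addrC [s ^+ l * _]mulrC.
  congr (_ + _).
  rewrite mulr_sumr; apply: eq_bigr => i _.
  have il := ltn_ord i.
  have -> : j r ^+ l = j r ^+ (l - i) * j r ^+ i by rewrite -exprD subnK // ltnW.
  by rewrite prednK ?subn_gt0 // exprMn; ring.
have -> : j (t ^+ l + w * r) = (j t ^+ l - (s * j r) ^+ l) +
    \sum_(i < l) (j f`_i * j r ^+ (l - i).-1.+1) * (j t ^+ i - (s * j r) ^+ i).
  rewrite -[LHS]subr0 -[X in _ - X = _]E rmorphD rmorphXn rmorphM rmorph_sum mulr_suml.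
  rewrite opprD addrACA; congr (_ + _); rewrite -sumrB; apply: eq_bigr => i _.
  by rewrite !rmorphM !rmorphXn exprS; ring.
have [_ D _] := mq; apply: D => //.
apply: (sq l (fun i => (j f`_i * j r ^+ (l - i).-1.+1) * (j t ^+ i - (s * j r) ^+ i))).
by move=> i _; apply: ideal_mulr.
Qed.

End IntegralExtension.

(** * Lifting idempotents and uniqueness of the prime over m *)

Section IdempotentLifting.
Variables (R : comNzRingType) (m : idealr R).
Implicit Types (f g w e : {poly R}).

Definition small n g := forall i, ideal_power m n g`_i.

Lemma small_0 g : small 0 g.
Proof.
move=> i; exists 1%N, (fun=> g`_i), (fun _ _ => 0).
by split=> [? []//|]; rewrite big_ord1 big_ord0 mulr1.
Qed.

Lemma smallD n g w : small n g -> small n w -> small n (g + w).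
Proof.
move=> sg sw i; rewrite coefD.
by have [_ D _] := ideal_power_ideal m n; apply: D.
Qed.

Lemma small_sum n k (h : nat -> R) :
  (forall i, (i < k)%N -> ideal_power m n (h i)) ->
  ideal_power m n (\sum_(i < k) h i).
Proof.
have [I0 D _] := ideal_power_ideal m n.
elim: k => [|k IH] hh; first by rewrite big_ord0.
rewrite big_ord_recr; apply: D; last exact: hh.
by apply: IH => i ik; apply/hh/ltnW.
Qed.

Lemma smallMr n g w : small n g -> small n (w * g).
Proof.
move=> sg i; rewrite coefM.
apply: (small_sum (h := fun j => w`_j * g`_(i - j)%N)) => j _.
exact: (ideal_mulr _ (ideal_power_ideal m n)).
Qed.

Lemma smallB n g w : small n g -> small n w -> small n (g - w).
Proof. by move=> sg sw; apply: smallD => //; rewrite -mulN1r; apply: smallMr. Qed.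

Lemma smallS n g : small n.+1 g -> small n g.
Proof. by move=> sg i; apply/ideal_power_dec/sg. Qed.

Lemma smallM n g w : small 1 g -> small n w -> small n.+1 (g * w).
Proof.
move=> sg sw i; rewrite coefM.
apply: (small_sum (h := fun j => g`_j * w`_(i - j)%N)) => j _.
by apply: ideal_power_mul => //; apply/ideal_power1.
Qed.

Variable f : {poly R}.
Hypothesis fmon : f \is monic.

(** Division by a monic polynomial does not leave the ideal generated by the
    coefficients of the dividend. *)
Lemma monic_reduction n g : small n g ->
  exists w, (size (g - w * f)%R < size f)%N /\ small n (g - w * f).
Proof.
have [k] := ubnP (size g); elim: k g => // k IH g; rewrite ltnS => sk sg.
have [gf|fg] := ltnP (size g) (size f).
  by exists 0; rewrite mul0r subr0.
have f0 : (0 < size f)%N by rewrite size_poly_gt0 monic_neq0.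
have g0 : (0 < size g)%N by apply: leq_trans fg.
pose c := (lead_coef g)%:P * 'X^(size g - size f).
have sc : small n (c * f).
  rewrite mulrC; apply: smallMr => i.
  rewrite coefCM coefXn; have [_|_] := eqP; last first.
    by rewrite mulr0; case: (ideal_power_ideal m n).
  by rewrite mulr1; apply: sg.
have [||w [sw sw']] := IH (g - c * f).
- apply: leq_trans sk; rewrite -(prednK g0) ltnS; apply/leq_sizeP => i gi.
  rewrite coefB /c -mulrA [_ * f]mulrC coefCM coefMXn.
  have [ilt|ige] := ltnP i (size g - size f).
    by exfalso; lia.
  move: gi; rewrite leq_eqVlt => /orP[/eqP gi|gi].
    rewrite -gi; have -> : ((size g).-1 - (size g - size f) = (size f).-1)%N.
      by lia.
    by rewrite -!/(lead_coef _) (monicP fmon) mulr1 subrr.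
  have fi : (size f <= i - (size g - size f))%N by lia.
  have gi' : (size g <= i)%N by lia.
  by rewrite (nth_default _ gi') (nth_default _ fi) mulr0 subr0.
- exact: smallB.
exists (c + w); rewrite mulrDl opprD addrA; split=> //.
Qed.

(** The quotients [w] for different [n] agree, because the quotient of the
    division by a monic polynomial is unique; so the remainder has coefficients
    in every power of [m]. *)
Lemma small_unique g : adically_complete m ->
  (forall n, exists w, small n (g - w * f)) -> exists w, g = w * f.
Proof.
move=> [sep _] sg.
have /choice[w wP] n : exists w,
    (size (g - w * f)%R < size f)%N /\ small n (g - w * f)%R.
  have [w sw] := sg n; have [w' [s1 s2]] := monic_reduction sw.
  by exists (w + w'); rewrite mulrDl opprD addrA.
have wE n : w n = w 0%N.
  apply/eqP; rewrite -subr_eq0; apply/negPn/negP => w0.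
  have := size_Mmonic w0 fmon.
  have -> : (w n - w 0%N) * f = (g - w 0%N * f) - (g - w n * f) by ring.
  have le : (size (g - w 0%N * f - (g - w n * f))%R <= (size f).-1)%N.
    apply: leq_trans (size_polyD _ _) _; rewrite size_polyN geq_max.
    by move: (wP 0%N).1 (wP n).1; case: (size f) => // k; rewrite !ltnS => -> ->.
  move=> E; rewrite E in le.
  have w1 : (0 < size (w n - w 0%N)%R)%N by rewrite size_poly_gt0.
  have f1 : (0 < size f)%N by rewrite size_poly_gt0 monic_neq0.
  by move: le w1 f1; move: (size (w n - w 0%N)) (size f); lia.
exists (w 0%N); apply/eqP; rewrite -subr_eq0; apply/eqP/polyP => i.
rewrite coef0; apply: sep => n; rewrite -(wE n).
by case: (wP n) => _; apply.
Qed.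

(** Newton's iteration e |-> 3 e^2 - 2 e^3 for the equation e^2 = e, in the
    algebra R[X]/(f). Each iterate is reduced modulo [f], which bounds its
    degree and makes the limit a polynomial. Linear convergence is enough. *)
Lemma lift_idempotent e0 : adically_complete m ->
  (exists w, small 1 (e0 ^+ 2 - e0 - w * f)) ->
  exists e, (exists w, e ^+ 2 - e = w * f) /\ exists w, small 1 (e - e0 - w * f).
Proof.
move=> cR ie0.
pose P n e := (size e < size f)%N /\ exists w, small n (e ^+ 2 - e - w * f).
(* With [D] equal to e^2 - e, the iterate is e - (2 e - 1) D, and its own defect
   is D^2 (4 D - 3). *)
have step n e : P n.+1 e -> exists e', P n.+2 e' /\ small n.+1 (e' - e).
  move=> [se [w sw]]; set g := e ^+ 2 - e - w * f in sw.
  have [w' [s1 s2]] := monic_reduction (smallMr (- (2%:R * e - 1)) sw).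
  set d := _ - w' * f in s1 s2.
  exists (e + d); split; last by rewrite addrC addKr.
  split; first by rewrite (leq_ltn_trans (size_polyD _ _)) // gtn_max se.
  pose D := g + w * f; pose c := (2%:R * e - 1) * w - w'.
  pose e2 := e - (2%:R * e - 1) * D.
  exists (w * (4%:R * (D ^+ 2 + D * g + g ^+ 2) - 3%:R * (D + g)) +
          c * (2%:R * e2 - 1 + f * c)).
  have sg1 k : small k.+1 g -> small 1 g by elim: k => // k IH /smallS.
  suff -> : (e + d) ^+ 2 - (e + d) - (w * (4%:R * (D ^+ 2 + D * g + g ^+ 2) -
      3%:R * (D + g)) + c * (2%:R * e2 - 1 + f * c)) * f =
      (4%:R * g - 3%:R) * (g * g).
    by apply/smallMr/smallM => //; apply: sg1 sw.
  have DE : D = e ^+ 2 - e by rewrite /D /g; ring.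
  have e2E : e2 ^+ 2 - e2 = D ^+ 2 * (4%:R * D - 3%:R) by rewrite /e2 DE; ring.
  have -> : e + d = e2 + f * c by rewrite /d /e2 /c /D; ring.
  have -> : (e2 + f * c) ^+ 2 - (e2 + f * c) = (e2 ^+ 2 - e2) +
    f * c * (2%:R * e2 - 1 + f * c) by ring.
  by rewrite e2E /D; ring.
have [w0 [sw0 _]] := monic_reduction (small_0 e0).
pose e1 := e0 - w0 * f.
have P1 : P 1%N e1.
  split=> //; have [w sw] := ie0.
  exists (w + w0 * w0 * f - 2%:R * e0 * w0 + w0).
  suff -> : e1 ^+ 2 - e1 - (w + w0 * w0 * f - 2%:R * e0 * w0 + w0) * f =
    e0 ^+ 2 - e0 - w * f by [].
  by rewrite /e1; ring.
have [u [u0 uP]] : exists u : nat -> {poly R}, u 0%N = e1 /\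
    forall n, P n.+1 (u n) /\ small n.+1 (u n.+1 - u n).
  have stp (x : {ne : nat * {poly R} | P ne.1.+1 ne.2}) :
      {y : {ne : nat * {poly R} | P ne.1.+1 ne.2} |
        (sval y).1 = (sval x).1.+1 /\ small (sval x).1.+1 ((sval y).2 - (sval x).2)}.
    case: x => -[n e] /= Pe; apply: cid; have [e' [Pe' se']] := step n e Pe.
    by exists (exist _ (n.+1, e') Pe').
  pose it n := iter n (fun x => sval (stp x)) (exist _ (0%N, e1) P1).
  have it1 n : (sval (it n)).1 = n.
    by elim: n => //= n IH; case: (svalP (stp (it n))) => -> _; rewrite IH.
  exists (fun n => (sval (it n)).2); split=> // n; split.
    by have := svalP (it n); rewrite it1.
  have sd : small (sval (it n)).1.+1 ((sval (it n.+1)).2 - (sval (it n)).2) :=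
    (svalP (stp (it n))).2.
  by rewrite it1 in sd.
have [_ lim] := cR.
have /choice[l lP] i : exists l, forall n, ideal_power m n ((u n)`_i - l).
  apply: lim => n; rewrite -coefB; apply: ideal_power_dec.
  by case: (uP n) => _; apply.
pose e := \poly_(i < size f) l i.
have ue n : small n (u n - e).
  move=> i; rewrite coefB coef_poly; case: ltnP => fi; first exact: lP.
  rewrite nth_default ?subr0; first by case: (ideal_power_ideal m n).
  by case: (uP n) => -[se _] _; apply: leq_trans (ltnW se) fi.
exists e; split.
  apply: (small_unique cR) => n; have [[_ [w sw]] _] := uP n; exists w.
  have -> : e ^+ 2 - e - w * f = (u n ^+ 2 - u n - w * f) -
    (u n + e - 1) * (u n - e) by ring.
  by apply: smallB (smallMr _ (ue n)); apply: smallS.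
exists (- w0).
have -> : e - e0 - - w0 * f = (u 1%N - u 0%N) - (u 1%N - e).
  by rewrite u0 /e1; ring.
by apply: smallB (ue 1%N); case: (uP 0%N).
Qed.

End IdempotentLifting.

Section UniquePrime.
Variables (R B : comNzRingType) (m : idealr R) (j : {rmorphism R -> B}).
Hypotheses (locR : noetherian_local_ring m) (cR : adically_complete m).
Hypothesis jint : forall b, integralOver j b.
Hypothesis Bint : forall x y : B, x * y = 0 -> x = 0 \/ y = 0.

(** Hensel's lemma. If [b] is in [M1] but not in [M2], its monic equation [f]
    factors modulo [m] as [q] times a power of the variable, with [q] not
    vanishing at 0. A Bezout relation gives an idempotent modulo [m] and [f],
    which lifts to R[X]/(f); its value at [b] is congruent to 0 modulo [M1] and
    to 1 modulo [M2]. But idempotents of a domain are 0 and 1. *)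
Lemma prime_over_unique (M1 M2 : set B) : prime_set M1 -> prime_set M2 ->
  (forall r, M1 (j r) <-> r \in m) -> (forall r, M2 (j r) <-> r \in m) ->
  M1 `<=` M2.
Proof.
move=> p1 p2 m1 m2 b M1b; apply: contrapT => M2b.
have [f fmon /rootP fb] := jint b.
have [k [chi [chis chi0]]] := residue_field locR.
pose ev (p : {poly R}) := (map_poly j p).[b].
have evD : {morph ev : p q / p + q} by move=> p q; rewrite /ev rmorphD hornerD.
have evM : {morph ev : p q / p * q} by move=> p q; rewrite /ev rmorphM hornerM.
have evB : {morph ev : p q / p - q}.
  by move=> p q; rewrite /ev rmorphB hornerD hornerN.
have evf w : ev (w * f) = 0 by rewrite evM {2}/ev fb mulr0.
have evE p : ev p = \sum_(i < size p) j p`_i * b ^+ i.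
  rewrite /ev (horner_coef_wide _ (size_poly _ _)).
  by apply: eq_bigr => i _; rewrite coef_map.
have chi_small (p : {poly R}) : map_poly chi p = 0 -> small m 1 p.
  by move=> p0 i; apply/ideal_power1/chi0; rewrite -coef_map p0 coef0.
have evsmall (M : set B) p : prime_set M -> (forall r, M (j r) <-> r \in m) ->
    small m 1 p -> M (ev p).
  move=> [mM _ _] Mm sp; have [M0 MD _] := mM.
  rewrite evE; apply: (big_ind M) => // i _; rewrite mulrC; apply: ideal_mulr => //.
  exact/Mm/ideal_power1.
have lift (v : {poly k}) : exists w, map_poly chi w = v.
  have /choice[c cP] i : exists r, v`_i = chi r := chis _.
  exists (\poly_(i < size v) c i); apply/polyP => i; rewrite coef_map coef_poly.
  case: ltnP => [_|vi]; first exact: (esym (cP i)).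
  by rewrite (nth_default _ vi); apply: rmorph0.
pose fk := map_poly chi f.
have fk0 : fk != 0 by apply: monic_neq0; apply: monic_map.
have [s [q /implyP/(_ fk0) q0 Eq]] := multiplicity_XsubC fk 0.
rewrite subr0 in Eq.
have [mM1 M11 _] := p1; have [mM2 M21 M2M] := p2.
have s0 : (0 < s)%N.
  case: s Eq => // Eq; case/negP: q0; rewrite -[q]mulr1 -[1](expr0 'X) -Eq.
  rewrite rootE horner_coef0 coef_map; apply/eqP/chi0/m1.
  have -> : j f`_0 = ev f - (ev f - j f`_0) by ring.
  have Ef : ev f - j f`_0 = \sum_(i < (size f).-1) j f`_i.+1 * b ^+ i.+1.
    have fl : (size f).-1.+1 = size f by rewrite prednK // size_poly_gt0 monic_neq0.
    by rewrite evE -[in LHS]fl big_ord_recl expr0 mulr1 addrAC subrr add0r.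
  rewrite Ef {1}/ev fb sub0r; apply: (submodN mM1).
  have [M10 M1D _] := mM1; apply: (big_ind M1) => // i _.
  by rewrite exprSr mulrA; apply: ideal_mulr.
have cop : coprimep q ('X^s).
  by apply: coprimep_expr; rewrite -['X]subr0 -polyC0 coprimep_XsubC.
have [[u v] /= uv] := Bezout_eq1_coprimepP _ _ cop.
have [U UE] := lift u; have [V VE] := lift v.
pose E0 := V * 'X^s.
have cE0 : map_poly chi E0 = v * 'X^s by rewrite rmorphM /= map_polyXn VE.
have [Q QE] := lift q.
have [e [[w we] [w' we']]] : exists e, (exists w, e ^+ 2 - e = w * f) /\
    exists w, small m 1 (e - E0 - w * f).
  apply: lift_idempotent => //; exists (- (U * V)); apply: chi_small.
  rewrite !rmorphB rmorphXn /= cE0 rmorphM rmorphN rmorphM /= UE VE -/fk Eq.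
  have -> : (v * 'X^s) ^+ 2 - v * 'X^s - - (u * v) * (q * 'X^s) =
    (v * 'X^s) * (u * q + v * 'X^s - 1) by ring.
  by rewrite uv subrr mulr0.
have bXs n : ev 'X^n = b ^+ n by rewrite /ev map_polyXn hornerXn.
have M1e : M1 (ev e).
  have -> : e = (e - E0 - w' * f) + V * 'X^s + w' * f by rewrite /E0; ring.
  rewrite evD evf addr0 evD; have [_ D _] := mM1; apply: D.
    exact: (evsmall _ _ p1 m1 we').
  rewrite evM; apply: ideal_mulr => //; rewrite bXs -(prednK s0) exprSr.
  exact: ideal_mulr.
have M2e : M2 (1 - ev e).
  have : M2 ((1 - ev E0) * b ^+ s).
    rewrite -bXs -(_ : ev 1 = 1); last by rewrite /ev rmorph1 hornerC.
    rewrite -evB -evM.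
    have -> : (1 - E0) * 'X^s = ((1 - E0) * 'X^s - U * f) + U * f by ring.
    rewrite evD evf addr0; apply: (evsmall _ _ p2 m2); apply: chi_small.
    rewrite rmorphB !rmorphM rmorphB rmorph1 /= cE0 map_polyXn UE -/fk Eq -uv; ring.
  move=> /M2M[M2E0|/(prime_setX p2)//].
  have -> : 1 - ev e = (1 - ev E0) - ev (e - E0 - w' * f).
    by rewrite evB evf subr0 evB; ring.
  exact: (submodB mM2 M2E0 (evsmall _ _ p2 m2 we')).
have : ev e * (ev e - 1) = 0.
  by rewrite mulrBr mulr1 -expr2; have := evf w; rewrite -we evB expr2 evM -expr2.
move=> /Bint[e0|/subr0_eq e1].
  by apply: M21; rewrite e0 subr0 in M2e.
by apply: M11; rewrite e1 in M1e.
Qed.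

End UniquePrime.

(** * Syzygies over a coherent ring *)

Section Syzygies.
Variable A : comNzRingType.

(** Schanuel's lemma for the presentation [f] provided by coherence and the
    presentation given by (x, z). Express the images under [f] of the basis
    vectors as p_i x + q_i z. Then every vector [v] has f v = P v x + Q v z,
    so vectors in the kernel of [f] give syzygies, and so do the differences
    between the unit vectors and the images of lifts [vx], [vz] of [x], [z].
    These syzygies generate. *)
Lemma coherent_syzygies (x z : A) : coherent A ->
  exists k (r s : 'I_k -> A), (forall i, r i * z = s i * x) /\
    forall u v, u * z = v * x -> exists c : 'I_k -> A,
      u = \sum_(i < k) c i * r i /\ v = \sum_(i < k) c i * s i.
Proof.
move=> cohA.
pose I : set A^o := [set e | exists c : 'I_2 -> A,
  e = \sum_(i < 2) c i *: ((if i == ord0 then x else z) : A^o)].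
have IE p q : I (p * x + q * z).
  exists (fun i => if i == ord0 then p else q).
  by rewrite !big_ord_recl big_ord0 addr0.
have [|n [f [fI [t [kap kapP]]]]] := cohA I.
  by exists 2%N, (fun i => if i == ord0 then x else z).
have [vx fvx] : exists v, f v = x.
  have : I x by have := IE 1 0; rewrite mul1r mul0r addr0.
  by rewrite -fI => -[v _ <-]; exists v.
have [vz fvz] : exists v, f v = z.
  have : I z by have := IE 0 1; rewrite mul1r mul0r add0r.
  by rewrite -fI => -[v _ <-]; exists v.
have /choice[pq pqP] (i : 'I_n) : exists pq : A * A,
    f (delta_mx 0 i) = pq.1 * x + pq.2 * z.
  have : I (f (delta_mx 0 i)) by rewrite -fI; exists (delta_mx 0 i).
  case=> c ->; exists (c ord0, c (lift ord0 ord0)).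
  by rewrite !big_ord_recl big_ord0 addr0.
pose P (v : 'rV[A]_n) := \sum_(i < n) v 0 i * (pq i).1.
pose Q (v : 'rV[A]_n) := \sum_(i < n) v 0 i * (pq i).2.
have fPQ v : f v = P v * x + Q v * z.
  rewrite [in LHS](row_sum_delta v) linear_sum /= /P /Q !mulr_suml -big_split /=.
  apply: eq_bigr => i _; rewrite linearZ /= pqP /GRing.scale /=; ring.
have linPQ (h : 'I_n -> A) (u v : A) (cf : 'I_t -> A) :
    u *: vz - v *: vx = \sum_(i < t) cf i *: kap i ->
    u * (\sum_(i < n) vz 0 i * h i) - v * (\sum_(i < n) vx 0 i * h i) =
    \sum_(i < t) cf i * (\sum_(l < n) kap i 0 l * h l).
  move=> E; transitivity (\sum_(i < n) (u *: vz - v *: vx) 0 i * h i).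
    rewrite !mulr_sumr -sumrB; apply: eq_bigr => i _; rewrite !mxE; ring.
  rewrite E (eq_bigr (fun i => \sum_(l < t) cf l * (kap l 0 i * h i))).
    by rewrite exchange_big; apply: eq_bigr => i _; rewrite mulr_sumr.
  move=> i _; rewrite summxE mulr_suml; apply: eq_bigr => l _.
  by rewrite !mxE mulrA.
pose ext (p q : A) (g : 'I_t -> A) (i : 'I_t.+2) : A :=
  if unlift ord0 i is Some i' then
    if unlift ord0 i' is Some i'' then g i'' else q
  else p.
have extE (c1 c2 p q : A) (g cf : 'I_t -> A) :
    \sum_(i < t.+2) ext c1 c2 cf i * ext p q g i =
    c1 * p + (c2 * q + \sum_(i < t) cf i * g i).
  rewrite !big_ord_recl /ext !liftK !unlift_none; congr (_ + (_ + _)).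
  by apply: eq_bigr => i _; rewrite !liftK.
have fkap i : f (kap i) = 0.
  have : (f @^-1` [set 0]) (kap i).
    rewrite kapP; exists (fun l => (l == i)%:R).
    rewrite (bigD1 i) //= eqxx scale1r big1 ?addr0 // => l /negPf ->.
    by rewrite scale0r.
  by [].
exists t.+2, (ext (1 - Q vz) (Q vx) (fun i => Q (kap i))),
  (ext (P vz) (1 - P vx) (fun i => - P (kap i))); split.
  move=> i; rewrite /ext; case: (unlift _ i) => [i'|]; last first.
    have Ez : P vz * x + Q vz * z = z by rewrite -fPQ.
    by rewrite mulrBl mul1r -{1}Ez addrK.
  case: (unlift _ i') => [l|]; last first.
    have Ex : P vx * x + Q vx * z = x by rewrite -fPQ.
    by rewrite mulrBl mul1r -{1}Ex addrAC subrr add0r.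
  have := fkap l; rewrite fPQ => /eqP; rewrite addr_eq0 => /eqP E.
  by rewrite mulNr E opprK.
move=> u v uv.
have : (f @^-1` [set 0]) (u *: vz - v *: vx).
  have : f (u *: vz - v *: vx) = 0; last by [].
  by rewrite linearB !linearZ /= fvx fvz /GRing.scale /= uv mulrN subrr.
rewrite kapP => -[cf E]; exists (ext u v cf); rewrite !extE.
have EP := linPQ (fun i => (pq i).1) u v cf E.
have EQ := linPQ (fun i => (pq i).2) u v cf E.
split; first by rewrite /Q -EQ; ring.
rewrite /P (eq_bigr (fun i => - (cf i * (\sum_(l < n) kap i 0 l * (pq l).1)))).
  by rewrite sumrN -EP; ring.
by move=> i _; rewrite mulrN.
Qed.

End Syzygies.

(** * Rings in which monic polynomials split *)

Definition monic_splits (B : comNzRingType) : Prop := forall p : {poly B},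
  p \is monic -> exists s : seq B, p = \prod_(a <- s) ('X - a%:P).

Section Splitting.
Variable B : comNzRingType.
Hypothesis Bsplit : monic_splits B.

Lemma monic_splits_root (p : {poly B}) : p \is monic -> (1 < size p)%N ->
  exists b, p.[b] = 0.
Proof.
move=> pmon; have [[|a s] ->] := Bsplit pmon.
  by rewrite big_nil size_poly1.
by exists a; rewrite big_cons hornerM hornerXsubC subrr mul0r.
Qed.

Lemma monic_splits_nroot n (b : B) : exists a, a ^+ n.+1 = b.
Proof.
have [||a] := @monic_splits_root ('X^(n.+1) - b%:P).
- exact: monicXnsubC.
- by rewrite size_XnsubC.
by rewrite hornerD hornerN hornerXn hornerC => /subr0_eq; exists a.
Qed.

(** The image of a product of linear factors only has roots in the image. *)
Lemma monic_splits_lift (F : fieldType) (psi : {rmorphism B -> F}) (p : {poly B}) rho :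
  p \is monic -> (map_poly psi p).[rho] = 0 -> exists2 b, rho = psi b & p.[b] = 0.
Proof.
move=> pmon; have [s ->] := Bsplit pmon; elim: s => [|a s IH].
  by rewrite big_nil rmorph1 hornerC => /eqP; rewrite oner_eq0.
rewrite big_cons rmorphM hornerM => /eqP; rewrite mulf_eq0 => /orP[|/eqP/IH[b -> pb]].
  rewrite rmorphB /= map_polyX map_polyC hornerXsubC subr_eq0 => /eqP ->.
  by exists a => //; rewrite hornerM hornerXsubC subrr mul0r.
by exists b => //; rewrite hornerM pb mulr0.
Qed.

Lemma monic_splits_nroot_lift (F : fieldType) (psi : {rmorphism B -> F}) n b rho :
  rho ^+ n.+1 = psi b -> exists2 a, rho = psi a & a ^+ n.+1 = b.
Proof.
move=> E; have [||a -> ] := @monic_splits_lift _ psi ('X^(n.+1) - b%:P) rho.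
- exact: monicXnsubC.
- by rewrite rmorphB /= map_polyXn map_polyC hornerD hornerN hornerXn hornerC E subrr.
by rewrite hornerD hornerN hornerXn hornerC => /subr0_eq; exists a.
Qed.

End Splitting.

(** * The rulings of a quadric *)

Section Quadric.
Variables (B : comNzRingType) (kappa : fieldType) (pi : {rmorphism B -> kappa}).

(** The quadric x y = z w contains a line w = l x, y = l z on which the
    syzygies of (x, z) are multiples of (x, z). The line is given by a map to
    a field whose kernel is contained in that of [pi], the residue map of the
    fixed maximal ideal. *)
Definition ruling (x y z w l : B) : Prop :=
  exists (F : fieldType) (psi : {rmorphism B -> F}),
    [/\ psi w = psi l * psi x /\ psi y = psi l * psi z,
        psi x <> 0 \/ psi z <> 0,
        forall b, psi b = 0 -> pi b = 0 &
        forall rho r s, rho * psi x = psi r -> rho * psi z = psi s ->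
          exists b, rho = psi b].

Hypothesis Bsplit : monic_splits B.
Hypothesis Bint : forall x y : B, x * y = 0 -> x = 0 \/ y = 0.

(** With k generating syzygies and n = k+1, choose compatible n-th roots [al],
    [be], [ga], [de] of x, w, z, y. On a line of slope l the monomial syzygies
    are the mu^i (x, z), i <= n, where mu^n = l, and the generators are
    multiples of (x, z). Expressing the former by the latter shows that, modulo
    the maximal ideal, the Vandermonde matrix of n+1 lines factors through a
    space of dimension k. *)
Lemma ruling_bound (x y z w : B) : coherent B -> x <> 0 -> x * y = z * w ->
  exists k, forall l : 'I_k -> B, (forall i j, i <> j -> pi (l i) <> pi (l j)) ->
    ~ forall i, ruling x y z w (l i).
Proof.
move=> cohB x0 xyzw; have [k [r [s [rs gen]]]] := coherent_syzygies x z cohB.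
exists k.+2 => l ldist lrul; pose n := k.+1.
have [al alE] := monic_splits_nroot Bsplit k x.
have [be beE] := monic_splits_nroot Bsplit k w.
have [ga gaE] := monic_splits_nroot Bsplit k z.
(* An arbitrary n-th root of [y] would satisfy [al * de = be * ga] up to a root
   of unity only; so divide in the fraction field, where the quotient is
   an n-th root of [y] and hence comes from [B]. *)
have [de de1 deE] : exists2 de, al * de = be * ga & de ^+ n = y.
  have [F [f finj]] := integral_domain_fraction Bint.
  have fal : f al != 0.
    apply/eqP => fal; apply: x0; apply: finj.
    by rewrite -alE rmorphXn fal exprS mul0r rmorph0.
  have [|de fde deE] := @monic_splits_nroot_lift _ Bsplit _ f k y (f be * f ga / f al).
    rewrite expr_div_n exprMn -!rmorphXn beE gaE alE -rmorphM mulrC.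
    apply: (mulfI (_ : f x != 0)); first by rewrite -alE rmorphXn expf_neq0.
    rewrite mulrA divff ?mul1r -?rmorphM ?xyzw ?[z * w]mulrC //.
    by rewrite -alE rmorphXn expf_neq0.
  exists de => //; apply: finj; rewrite !rmorphM -fde.
  by rewrite mulrCA divff // mulr1.
have /choice[c cP] (i : 'I_n.+1) : exists c : 'I_k -> B,
    al ^+ (n - i) * be ^+ i = \sum_(j < k) c j * r j /\
    ga ^+ (n - i) * de ^+ i = \sum_(j < k) c j * s j.
  apply: gen; rewrite -gaE -alE -/n.
  have Dn a : a ^+ n = a ^+ (n - i) * a ^+ i :> B.
    by rewrite -exprD subnK // leq_ord.
  rewrite (Dn ga) (Dn al).
  transitivity ((al * ga) ^+ (n - i) * (be * ga) ^+ i); first by rewrite !exprMn; ring.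
  by rewrite -de1 !exprMn; ring.
have /choice[mb mbP] (i : 'I_n.+1) : exists mb : B * ('I_k -> B),
    pi mb.1 ^+ n = pi (l i) /\
    forall j : 'I_n.+1, pi (mb.1 ^+ j) = pi (\sum_(h < k) c j h * mb.2 h).
  have [F [psi [[E1 E2] nz ker S2]]] := lrul i.
  have kerE u v : psi u = psi v -> pi u = pi v.
    move=> uv; apply/eqP; rewrite -subr_eq0 -rmorphB; apply/eqP/ker.
    by rewrite rmorphB uv subrr.
  have /choice[b bP] h : exists b, psi b * psi x = psi (r h) /\ psi b * psi z = psi (s h).
    have E : psi (r h) * psi z = psi (s h) * psi x by rewrite -!rmorphM rs.
    have [rho rho1 rho2] : exists2 rho, rho * psi x = psi (r h) & rho * psi z = psi (s h).
      case: nz => /eqP nz.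
        exists (psi (r h) / psi x); first by rewrite divfK.
        by apply: (mulIf nz); rewrite mulrAC divfK.
      exists (psi (s h) / psi z); last by rewrite divfK.
      by apply: (mulIf nz); rewrite mulrAC divfK.
    by have [b Eb] := S2 _ _ _ rho1 rho2; exists b; rewrite -Eb.
  (* The slope between the n-th roots; one of [psi al], [psi ga] may vanish,
     but not both. *)
  have [mu [mu1 mu2 mun]] : exists mu, [/\ psi be = mu * psi al,
      psi de = mu * psi ga & mu ^+ n = psi (l i)].
    have Ede : psi al * psi de = psi be * psi ga by rewrite -!rmorphM de1.
    have [al0|al0] := eqVneq (psi al) 0; last first.
      exists (psi be / psi al); split; first by rewrite divfK.
        by apply: (mulfI al0); rewrite Ede mulrAC [RHS]mulrC divfK.
      rewrite expr_div_n -!rmorphXn beE alE E1 mulfK //.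
      by rewrite -alE rmorphXn expf_neq0.
    have x00 : psi x = 0 by rewrite -alE rmorphXn al0 exprS mul0r.
    have ga0 : psi ga != 0.
      case: nz => // nz; apply/eqP => ga0; apply: nz.
      by rewrite -gaE rmorphXn ga0 exprS mul0r.
    exists (psi de / psi ga); split; last 1 first.
    - rewrite expr_div_n -!rmorphXn deE gaE E2 mulfK //.
      by rewrite -gaE rmorphXn expf_neq0.
    - have : psi be ^+ k.+1 == 0 by rewrite -rmorphXn beE E1 x00 mulr0.
      by rewrite expf_eq0 al0 mulr0 => /eqP.
    - by rewrite divfK.
  have [b0 Eb0 b0n] := monic_splits_nroot_lift Bsplit mun.
  exists (b0, b) => /=; split; first by rewrite -rmorphXn b0n.
  move=> j; apply: kerE; rewrite rmorphXn -Eb0 rmorph_sum.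
  have [cP1 cP2] := cP j.
  have muE u v : psi u = mu * psi v ->
      psi (v ^+ n) * mu ^+ j = psi (v ^+ (n - j) * u ^+ j).
    move=> Eu; have -> : v ^+ n = v ^+ (n - j) * v ^+ j.
      by rewrite -exprD subnK // leq_ord.
    by rewrite !rmorphM !rmorphXn Eu exprMn; ring.
  case: nz => /eqP nz; apply: (mulIf nz).
    rewrite mulrC -{1}alE (muE be al) // cP1 rmorph_sum mulr_suml.
    by apply: eq_bigr => h _; rewrite !rmorphM -mulrA (bP h).1.
  rewrite mulrC -{1}gaE (muE de ga) // cP2 rmorph_sum mulr_suml.
  by apply: eq_bigr => h _; rewrite !rmorphM -mulrA (bP h).2.
pose V := Vandermonde n.+1 (\row_(i < n.+1) pi (mb i).1).
have VE : V = (\matrix_(i < n.+1, h < k) pi (c i h)) *m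
              (\matrix_(h < k, i < n.+1) pi ((mb i).2 h)).
  apply/matrixP => i h; rewrite !mxE -rmorphXn (mbP h).2 rmorph_sum.
  by apply: eq_bigr => e _; rewrite !mxE rmorphM.
have : V \in unitmx.
  rewrite unitmxE unitfE det_Vandermonde; apply/prodf_neq0 => i _.
  apply/prodf_neq0 => h ih; rewrite !mxE subr_eq0; apply/eqP => E.
  apply: (ldist h i) => [hi|]; first by rewrite hi ltnn in ih.
  by rewrite -!(mbP _).1 E.
rewrite -row_free_unit -row_leq_rank VE => rk.
by have := leq_trans rk (mulmx_max_rank _ _); rewrite /n ltnNge leqnSn.
Qed.

End Quadric.

(** * Slopes and the condition on them *)

Section Sylvester.
Variable R : comNzRingType.

(** The recursion of Sylvester's sequence: [sylvester l] is 1 plus the product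
    of X and all earlier terms, so that any two terms generate the unit ideal
    over every ring, and their roots are distinct in every field. *)
Fixpoint sylvester_prod l : {poly R} :=
  if l is l'.+1 then sylvester_prod l' * (sylvester_prod l' + 1) else 'X.

Definition sylvester l := sylvester_prod l + 1.

Lemma sylvester_prod_monic l :
  sylvester_prod l \is monic /\ (1 < size (sylvester_prod l))%N.
Proof.
elim: l => [|l [pmon sp]] /=; first by rewrite monicX size_polyX.
have lt : (size (1%R : {poly R}) < size (sylvester_prod l))%N by rewrite size_poly1.
have qmon : sylvester_prod l + 1 \is monic by rewrite monicE lead_coefDl.
split; first by rewrite monicMl.
by rewrite size_monicM ?monic_neq0 // size_polyDl //; lia.
Qed.

Lemma sylvester_monic l : sylvester l \is monic /\ (1 < size (sylvester l))%N.
Proof.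
have [pmon sp] := sylvester_prod_monic l.
have lt : (size (1%R : {poly R}) < size (sylvester_prod l))%N by rewrite size_poly1.
by rewrite /sylvester monicE lead_coefDl // size_polyDl // -monicE.
Qed.

Lemma sylvester_coprime i k : (i < k)%N -> exists u, sylvester k = u * sylvester i + 1.
Proof.
move=> ik; rewrite /sylvester.
suff [u ->] : exists u, sylvester_prod k = u * sylvester i by exists u.
elim: k ik => // k IH; rewrite ltnS leq_eqVlt => /orP[/eqP ->|/IH[u E]] /=.
  by exists (sylvester_prod k).
by rewrite {1}E; exists (u * (sylvester_prod k + 1)); rewrite mulrAC.
Qed.

Lemma sylvester_root_neq (B : comNzRingType) (j : {rmorphism R -> B}) i k b :
  (map_poly j (sylvester i)).[b] = 0 -> (map_poly j (sylvester k)).[b] = 0 -> i = k.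
Proof.
have lt i' k' : (i' < k')%N -> (map_poly j (sylvester i')).[b] = 0 ->
    (map_poly j (sylvester k')).[b] = 0 -> False.
  move=> /sylvester_coprime[u ->]; move: (sylvester i') => p.
  rewrite rmorphD rmorphM rmorph1 /= hornerD hornerM hornerC => ->; rewrite mulr0 add0r => /eqP.
  by rewrite oner_eq0.
by move=> bi bk; case: (ltngtP i k) => // ik; case: (lt _ _ ik).
Qed.

End Sylvester.

(** [g] is the determinant of b - c M + a M^2 for the companion matrix [M] of
    [f]. If it vanishes in a field, then b - c X + a X^2 and [f] cannot be
    coprime, since a Bezout relation evaluated at [M] would invert the matrix.
    It lies in [m] because the matrix vanishes over the residue field. *)
Lemma common_root_det (R : comNzRingType) (m : idealr R) (f : {poly R}) a b c :
  noetherian_local_ring m -> f \is monic -> (1 < size f)%N ->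
  a \in m -> b \in m -> c \in m ->
  exists2 g, g \in m & forall (F : fieldType) (phi : {rmorphism R -> F}),
    (exists s : seq F, map_poly phi f = \prod_(u <- s) ('X - u%:P)) -> phi g = 0 ->
    exists2 l, (map_poly phi f).[l] = 0 & phi b - l * phi c + l ^+ 2 * phi a = 0.
Proof.
move=> locR fmon sf am bm cm.
have [d [M ME]] : exists d (M : 'M[R]_d.+1), char_poly M = f.
  have : exists M : 'M[R]_((size f).-1), char_poly M = f.
    by exists (companionmx f); apply: companionmxK.
  have : (0 < (size f).-1)%N by lia.
  by case: ((size f).-1) => [|d] // _ [M ME]; exists d, M.
pose q := b%:P - c%:P * 'X + a%:P * 'X^2.
have [k [chi [chis chi0]]] := residue_field locR.
have det_map (F : fieldType) (phi : {rmorphism R -> F}) :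
    phi (\det (horner_mx M q)) = \det (horner_mx (map_mx phi M) (map_poly phi q)).
  by rewrite -map_horner_mx det_map_mx.
exists (\det (horner_mx M q)) => [|F phi [s fs]].
  apply/chi0; rewrite det_map.
  have -> : map_poly chi q = 0.
    rewrite /q !rmorphD rmorphN !rmorphM /= !map_polyC /=.
    by rewrite (chi0 a).2 // (chi0 b).2 // (chi0 c).2 // !polyC0 !mul0r subrr add0r.
  by rewrite rmorph0 det0.
rewrite det_map => /eqP det0.
have qE l : (map_poly phi q).[l] = phi b - l * phi c + l ^+ 2 * phi a.
  rewrite /q !rmorphD rmorphN !rmorphM /= !map_polyC /= !map_polyX.
  by rewrite !hornerE /=; ring.
apply: contrapT => noroot.
have cop : coprimep (map_poly phi q) (map_poly phi f).
  have sroot u : u \in s -> ~~ root (map_poly phi q) u.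
    move=> us; apply/negP => /rootP; rewrite qE => qu; apply: noroot.
    exists u => //; rewrite fs; apply/rootP; rewrite root_prod_XsubC //.
  rewrite fs big_seq; apply: (big_ind (coprimep (map_poly phi q))).
  - exact: coprimep1.
  - by move=> x y cx cy; rewrite coprimepMr cx.
  - by move=> u /sroot; rewrite coprimep_XsubC.
have [[u v] /= uv] := Bezout_eq1_coprimepP _ _ cop.
have : horner_mx (map_mx phi M) (u * map_poly phi q + v * map_poly phi f) = 1.
  by rewrite uv rmorph1.
rewrite rmorphD !rmorphM /= -ME map_char_poly Cayley_Hamilton mulr0 addr0.
move=> /(congr1 determinant); rewrite det_mulmx (eqP det0) mulr0 det1 => /eqP.
by rewrite eq_sym oner_eq0.
Qed.

Lemma pigeonhole_nat (A : nat -> Prop) k1 k2 :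
  (exists2 f : 'I_k1 -> nat, injective f & forall i, A (f i)) \/
  (exists2 f : 'I_k2 -> nat, injective f & forall i, ~ A (f i)).
Proof.
pose p i := `[< A i >]; pose s := iota 0 (k1 + k2).
have pick (q : pred nat) n : (n <= size (filter q s))%N ->
    exists2 f : 'I_n -> nat, injective f & forall i, q (f i).
  move=> le; have lt (i : 'I_n) : (i < size (filter q s))%N by apply: leq_trans le.
  exists (fun i => nth 0%N (filter q s) i) => [i i' /eqP|i].
    by rewrite nth_uniq ?filter_uniq ?iota_uniq // => /eqP ii; apply: val_inj.
  by have := mem_nth 0%N (lt i); rewrite mem_filter => /andP[].
have := count_predC p s; rewrite size_iota -!size_filter => E.
have [le|lt] := leqP k1 (size (filter p s)).
  by left; have [f fi fp] := pick _ _ le; exists f => // i; apply/asboolP/fp.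
right; have [|f fi fp] := pick (predC p) k2; first by lia.
by exists f => // i Ai; have /negP := fp i; apply; apply/asboolP.
Qed.

(** * Non-coherence *)

Section Main.
Variables (R B : comNzRingType) (m : idealr R) (j : {rmorphism R -> B}).
Hypotheses (locR : noetherian_local_ring m) (cR : adically_complete m).
Hypothesis dimR : krull_dim_gt R 3.
Hypothesis jint : forall b, integralOver j b.
Hypothesis jinj : injective j.
Hypothesis Bint : forall x y : B, x * y = 0 -> x = 0 \/ y = 0.
Hypothesis Bsplit : monic_splits B.

Let nR : noetherian_ring R := noetherian_self locR.1.

(** The kernel of [psi] lies over [P], and [P] < [P'] < m gives the dimension
    two that [integral_of_height_two] asks for. On the line, a, b and c are
    combinations of x = a and z, so some power of every element of [m]
    multiplies [rho] into the ring generated by the slope and the two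
    multiples of [rho]. *)
Lemma ruling_of_prime (P0 P P' : set R) (M q : set B) (kappa F : fieldType)
    (pi : {rmorphism B -> kappa}) (psi : {rmorphism B -> F}) a b c z w l :
  prime_set P -> P0 `<=` P -> prime_set P' -> P `<=` P' -> ~ (P' `<=` P) ->
  ~ ([set x | x \in m] `<=` P') ->
  (forall A, prime_set A -> P0 `<=` A -> A a -> A b -> A c -> [set x | x \in m] `<=` A) ->
  (forall r, psi (j r) = 0 <-> P r) -> (forall v, psi v = 0 -> pi v = 0) ->
  j c = z + w -> psi w = psi l * psi (j a) -> psi (j b) = psi l * psi z ->
  ruling pi (j a) (j b) z w l.
Proof.
move=> pP P0P pP' PP' P'P mP' hsop psiP ker Ec Ew Eb.
exists F, psi; split=> //.
  apply: contrapT => /not_orP[/contrapT a0 /contrapT z0].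
  have w0 : psi w = 0 by rewrite Ew a0 mulr0.
  apply: mP'; apply: subset_trans PP'; apply: hsop => //; apply/psiP => //.
    by rewrite Eb z0 mulr0.
  by rewrite Ec rmorphD z0 w0 addr0.
move=> rho r s rhox rhoz.
have [y [P'y Py]] : exists y, P' y /\ ~ P y.
  apply: contrapT => no; apply: P'P => y P'y.
  by apply: contrapT => Py; apply: no; exists y.
have [t [tm P't]] : exists t, t \in m /\ ~ P' t.
  apply: contrapT => no; apply: mP' => t tm.
  by apply: contrapT => Pt; apply: no; exists t.
have psiint v : integralOver (psi \o j) (psi v) by apply: integral_rmorph.
have [p pmon /rootP prho] : integralOver (psi \o j) rho.
  apply: (@integral_of_height_two R m locR cR F (psi \o j) P' y t rho
    [:: psi (j a); psi z; psi l; psi r; psi s]) => //.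
  - by apply/eqP => /psiP.
  - by move=> v /psiP /PP'.
  - by move=> v; rewrite !inE => /or4P[||| /orP[]] /eqP ->.
  move=> D [mD D1 DM _] Dws t' t'm.
  have [mP _ _] := pP.
  pose I := adjoin (adjoin (adjoin P a) b) c.
  have mI : ideal I by do 3!apply: adjoin_ideal.
  have [A pA IA|N [s3 [s2 [s1 /psiP E]]]] :=
      @radical_primes R I [set x | x \in m] nR mI _ t' t'm.
    have sub u : adjoin (adjoin P a) b u -> A u by move=> /(@adjoin_sub _ _ c) /IA.
    have sub' u : adjoin P a u -> A u by move=> /(@adjoin_sub _ _ b) /sub.
    apply: hsop => //.
    - by move=> u /P0P /(@adjoin_sub _ _ a) /sub'.
    - by apply/sub'/adjoin_mem.
    - by apply/sub/adjoin_mem/adjoin_ideal.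
    - by apply/IA/adjoin_mem; do 2!apply: adjoin_ideal.
  have [D0 DD DZ] := mD.
  exists N; have -> : (psi \o j) t' ^+ N * rho = (psi \o j) s1 * psi r +
      (psi \o j) s2 * (psi l * psi s) +
      (psi \o j) s3 * (psi s + psi l * psi r).
    have -> : (psi \o j) t' ^+ N = psi (j s1) * psi (j a) + psi (j s2) * psi (j b)
       + psi (j s3) * psi (j c).
      apply/eqP; rewrite -subr_eq0 -E /= !rmorphB !rmorphM !rmorphXn; apply/eqP; ring.
    by rewrite Ec rmorphD Ew Eb -rhox -rhoz /=; ring.
  have Dw v : v \in [:: psi (j a); psi z; psi l; psi r; psi s] -> D v := Dws v.
  have Dl : D (psi l) by apply: Dw; rewrite !inE eqxx !orbT.
  have Dr : D (psi r) by apply: Dw; rewrite !inE eqxx !orbT.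
  have Ds : D (psi s) by apply: Dw; rewrite !inE eqxx !orbT.
  apply: (DD); [apply: (DD)|]; apply: DZ => //; first exact: DM.
  by apply: DD => //; apply: DM.
have [v -> _] := @monic_splits_lift _ Bsplit _ psi (map_poly j p) rho (monic_map _ pmon)
  (etrans (congr1 (fun p => horner p rho) (esym (map_poly_comp _ _ _))) prho).
by exists v.
Qed.

(** It remains to find, for each n, a root of [sylvester n] that is the slope of
    a line in one of the two rulings; the pigeonhole principle then provides
    more lines in one ruling than [ruling_bound] allows. *)
Theorem absolutely_integrally_closed_not_coherent : ~ coherent B.
Proof.
move=> cohB.
have pm := maximal_prime locR.
have [P0 [a [b [c [hP0 [am P0a] bm cm hsop]]]]] :=
  system_of_parameters nR pm (prime_local locR) (krull_dim_coheight dimR).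
have [pP0 [P1 [[pP1 [P2 [[pP2 [P3 [[pP3 _] P23 P32]]] P12 P21]]] P01 P10]]] := hP0.
have mP2 : ~ ([set x | x \in m] `<=` P2).
  by move=> mP2; apply: P32; apply: subset_trans mP2; apply: prime_local pP3.
have m0 : ideal [set (0 : B)].
  by split=> // [u v -> ->|r u ->]; rewrite ?addr0 ?mulr0.
have over0 (p : set R) : prime_set p ->
    exists q, [/\ prime_set q, [set 0] `<=` q & forall r, q (j r) <-> p r].
  move=> pp; apply: (lying_over jint m0 pp) => r /=.
  by rewrite -(rmorph0 j) => /jinj ->; case: pp => -[].
have [M [pM _ Mm]] := over0 _ pm.
have [kappa [pi piM]] := prime_quotient_field pM.
have [z zE] : exists z, z ^+ 2 - j c * z + j a * j b = 0.
  have sz : (size ((j a * j b)%:P - (j c)%:P * 'X : {poly B})%R < 3)%N.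
    rewrite (leq_ltn_trans (size_polyD _ _)) // gtn_max size_polyN.
    rewrite (leq_ltn_trans (size_polyC_leq1 _)) //.
    by rewrite mul_polyC (leq_ltn_trans (size_scale_leq _ _)) // size_polyX.
  have [||z zE] := @monic_splits_root _ Bsplit
      ('X^2 + ((j a * j b)%:P - (j c)%:P * 'X)).
  - by rewrite monicE lead_coefDl ?size_polyXn // lead_coefXn.
  - by rewrite size_polyDl size_polyXn.
  exists z; rewrite -[RHS]zE !hornerE /=; ring.
pose w := j c - z.
have zw : j a * j b = z * w.
  by apply/eqP; rewrite -subr_eq0 -[X in _ == X]zE /w; apply/eqP; ring.
have a0 : j a <> 0.
  by rewrite -(rmorph0 j) => /jinj a0; apply: P0a; rewrite a0; case: pP0 => -[].
have [k1 bound1] := ruling_bound pi Bsplit Bint cohB a0 zw.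
have [k2 bound2] : exists k, forall l : 'I_k -> B,
    (forall i h, i <> h -> pi (l i) <> pi (l h)) ->
    ~ forall i, ruling pi (j a) (j b) w z (l i).
  by apply: (ruling_bound pi Bsplit Bint cohB a0); rewrite zw mulrC.
have /choice[l lP] n : exists l, (map_poly j (sylvester R n)).[l] = 0 /\
    (ruling pi (j a) (j b) z w l \/ ruling pi (j a) (j b) w z l).
  have [fmon fsz] := sylvester_monic R n.
  have [g gm gP] := common_root_det locR fmon fsz am bm cm.
  (* Two applications of the principal ideal theorem push [g] down the chain
     P0 < P1 < P2 < m, first into [P'], then into [P]. *)
  have [P' [pP' [P1P' P'P1] [P'm mP'] P'g]] :=
    prime_between nR pP1 pP2 pm P12 P21 (prime_local locR pP2) mP2 gm.
  have [P [pP [P0P _] [PP' P'P] Pg]] :=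
    prime_between nR pP0 pP1 pP' P01 P10 P1P' P'P1 P'g.
  have [q [pq _ qP]] := over0 _ pP.
  have [F [psi psiq]] := prime_quotient_field pq.
  have psiP r : psi (j r) = 0 <-> P r by rewrite psiq.
  have ker v : psi v = 0 -> pi v = 0.
    have [mq _ _] := pq.
    have [|M' [pM' qM' M'm]] := lying_over jint mq pm.
      by move=> r /qP /PP' /P'm.
    move=> /psiq /qM' M'v; apply/piM.
    exact: (prime_over_unique locR cR jint Bint pM' pM M'm Mm).
  have fjmon : map_poly j (sylvester R n) \is monic by apply: monic_map.
  have [s sE] := Bsplit fjmon.
  have [||lb lbroot lbE] := gP F (psi \o j).
  - exists (map psi s); rewrite map_poly_comp sE rmorph_prod big_map.
    by apply: eq_bigr => u _; rewrite rmorphB /= map_polyX map_polyC.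
  - exact/psiP.
  rewrite map_poly_comp in lbroot.
  have [l El lroot] := monic_splits_lift Bsplit fjmon lbroot.
  exists l; split=> //.
  have cE : j c = z + w by rewrite /w addrC subrK.
  have psic : psi (j c) = psi z + psi w by rewrite cE rmorphD.
  have psiab : psi (j a) * psi (j b) = psi z * psi w.
    by rewrite -(rmorphM psi (j a)) zw rmorphM.
  rewrite El /= psic in lbE.
  have : (psi w - psi l * psi (j a)) * (psi z - psi l * psi (j a)) = 0.
    transitivity (psi (j a) * (psi (j b) - psi l * (psi z + psi w) +
      psi l ^+ 2 * psi (j a))); last by rewrite lbE mulr0.
    by rewrite [RHS]mulrDr [X in _ = X + _]mulrBr psiab; ring.
  move=> /eqP; rewrite mulf_eq0 !subr_eq0 => /orP[/eqP Ew|/eqP Ez]; [left|right].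
  - apply: (ruling_of_prime M q pP P0P pP' PP' P'P mP' hsop psiP ker) => //.
    by apply/eqP; rewrite -subr_eq0 -[X in _ == X]lbE Ew; apply/eqP; ring.
  - apply: (ruling_of_prime M q pP P0P pP' PP' P'P mP' hsop psiP ker) => //.
      by rewrite addrC.
    by apply/eqP; rewrite -subr_eq0 -[X in _ == X]lbE Ez; apply/eqP; ring.
have ldist n n' : pi (l n) = pi (l n') -> n = n'.
  have rt i : (map_poly (pi \o j) (sylvester R i)).[pi (l i)] = 0.
    by rewrite map_poly_comp horner_map (lP i).1 rmorph0.
  move=> E; apply: (@sylvester_root_neq _ _ (pi \o j) n n' (pi (l n))) => //.
  by rewrite E.
have [[f finj fP]|[f finj fP]] :=
    pigeonhole_nat (fun n => ruling pi (j a) (j b) z w (l n)) k1 k2.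
  by apply: (bound1 (l \o f)) => [i h ih /ldist /finj //|i]; apply: fP.
apply: (bound2 (l \o f)) => [i h ih /ldist /finj //|i] /=.
by case: (lP (f i)) => _ [/fP|].
Qed.

End Main.

(** * The absolute integral closure *)

Section AbsoluteIntegralClosure.
Variables (R : idomainType) (K : closedFieldType)
  (iota : {rmorphism {fraction R} -> K}).

Let f0 : {rmorphism R -> K} := iota \o @tofrac R.
Let B : comNzRingType := absolute_integral_closure iota.
Let vB : {rmorphism B -> K} := \val.

Definition to_closure (r : R) : B :=
  Sub (f0 r) (introT (asboolP _) (integral_id f0 r)).

Lemma to_closureE r : vB (to_closure r) = f0 r.
Proof. exact: SubK. Qed.

Lemma vB_inj : injective vB. Proof. exact: val_inj. Qed.

Lemma to_closure_is_zmod : zmod_morphism to_closure.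
Proof. by move=> x y; apply: vB_inj; rewrite rmorphB !to_closureE rmorphB. Qed.

Lemma to_closure_is_monoid : monoid_morphism to_closure.
Proof.
split; first by apply: vB_inj; rewrite to_closureE !rmorph1.
by move=> x y; apply: vB_inj; rewrite rmorphM !to_closureE rmorphM.
Qed.

HB.instance Definition _ :=
  GRing.isZmodMorphism.Build R B to_closure to_closure_is_zmod.
HB.instance Definition _ :=
  GRing.isMonoidMorphism.Build R B to_closure to_closure_is_monoid.

Lemma to_closure_inj : injective to_closure.
Proof.
move=> x y /(congr1 vB); rewrite !to_closureE => /fmorph_inj /eqP.
by rewrite tofrac_eq => /eqP.
Qed.

Lemma closure_integral (b : B) : integralOver to_closure b.
Proof.
have /asboolP[p pmon /rootP pb] : vB b \in integral_elements f0 by exact: valP.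
exists p => //; apply/rootP/vB_inj; rewrite -horner_map rmorph0 -[RHS]pb.
by rewrite -map_poly_comp; congr (_.[_]); apply: eq_map_poly => r; apply: to_closureE.
Qed.

Lemma closure_domain (x y : B) : x * y = 0 -> x = 0 \/ y = 0.
Proof.
move=> /(congr1 vB)/eqP; rewrite rmorphM rmorph0 mulf_eq0 -(rmorph0 vB).
by case/orP => /eqP /vB_inj; [left | right].
Qed.

(** The roots in the algebraically closed field of a monic polynomial with
    integral coefficients are integral. *)
Lemma closure_splits : monic_splits B.
Proof.
move=> p pmon; have [s ps] := closed_field_poly_normal (map_poly vB p).
have pvmon : map_poly vB p \is monic by apply: monic_map.
rewrite (monicP pvmon) scale1r in ps.
have sint u : u \in s -> u \in integral_elements f0.
  move=> us; apply/asboolP; apply: (integral_root_monic pvmon).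
    by rewrite ps root_prod_XsubC.
  apply/integral_poly => i; rewrite coef_map.
  by have /asboolP : vB p`_i \in integral_elements f0 by exact: valP.
have [t ts] : exists t : seq B, map vB t = s.
  elim: s sint {ps} => [|u s IH] sint; first by exists [::].
  have [|t <-] := IH; first by move=> v vs; apply: sint; rewrite inE vs orbT.
  by exists ((Sub u (sint u (mem_head _ _)) : B) :: t).
exists t; apply: (map_inj_poly vB_inj); first exact: rmorph0.
rewrite ps -ts rmorph_prod big_map; apply: eq_bigr => u _.
rewrite rmorphB; congr (_ - _).
  exact: (esym (map_polyX vB)).
exact: (esym (map_polyC vB u)).
Qed.

End AbsoluteIntegralClosure.

Theorem corollary1p8 (R : idomainType) (m : idealr R)
    (K : closedFieldType) (iota : {rmorphism {fraction R} -> K}) :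
  noetherian_local_ring m ->
  adically_complete m ->
  mixed_characteristic m ->
  krull_dim_gt R 3 ->
  is_algebraic_closure iota ->
  ~ coherent (absolute_integral_closure iota).
Proof.
move=> locR cR _ dimR _.
exact: (@absolutely_integrally_closed_not_coherent R _ m (to_closure iota) locR cR
  dimR (@closure_integral _ _ iota) (@to_closure_inj _ _ iota)
  (@closure_domain _ _ iota) (@closure_splits _ _ iota)).
Qed.
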